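(* Let $R$ be an associative commutative unital ring, and let $\mathcal{C}$ be an $R$-linear triangulated category endowed with a bounded weight structure $w$. I. All virtual $t$-truncations (with respect to $w$) of functors of $R$-finite type (from $\mathcal{C}$) are of $R$-finite type also. II. Assume in addition that $\mathcal{C}$ is $R$-saturated. Then the following statements are valid. 1. For any $i\in\mathbb{Z}$ and $M\in\mathrm{Obj}\,\mathcal{C}$ the functors $\tau^{\le -i}(H_M)$ and $\tau^{\ge -i}(H_M)$ are representable, where $H_M=\mathcal{C}(-,M)$. 2. There exists a $t$-structure $t$ on $\mathcal{C}$ right adjacent to $w$. 3. The heart $\underline{Ht}$ of this $t$ naturally embeds (via $N\mapsto \mathcal{C}(-,N)|_{\underline{Hw}}$) into the category $\mathrm{AddFun}_R(\underline{Hw}^{op},R\text{-}\mathrm{mod})$. This embedding is essentially surjective whenever $R$ is noetherian.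
   Context: Weight structures: a pair $(\mathcal{C}_{w\le 0},\mathcal{C}_{w\ge 0})$ of classes of objects such that: (i) both are closed under retracts in $\mathcal{C}$; (ii) $\mathcal{C}_{w\le 0}\subset \mathcal{C}_{w\le 0}[1]$ and $\mathcal{C}_{w\ge 0}[1]\subset \mathcal{C}_{w\ge 0}$; (iii) $\mathcal{C}(X,Y)=0$ for $X\in\mathcal{C}_{w\le 0}$, $Y\in \mathcal{C}_{w\ge 0}[1]$; (iv) every object $M$ fits in a distinguished triangle $LM\to M\to RM\to LM[1]$ with $LM\in\mathcal{C}_{w\le 0}$, $RM\in \mathcal{C}_{w\ge 0}[1]$. Put $\mathcal{C}_{w\le i}=\mathcal{C}_{w\le 0}[i]$, $\mathcal{C}_{w\ge i}=\mathcal{C}_{w\ge 0}[i]$. The heart $\underline{Hw}$ is the full subcategory on $\mathcal{C}_{w\le 0}\cap\mathcal{C}_{w\ge 0}$. $w$ is bounded if $\bigcup_{i}\mathcal{C}_{w\le i}=\mathrm{Obj}\,\mathcal{C}=\bigcup_i\mathcal{C}_{w\ge i}$. A $t$-structure $t$ (cohomological convention) is right adjacent to $w$ if $\mathcal{C}^{t\le 0}=\mathcal{C}_{w\ge 0}$. For $m\in\mathbb{Z}$ choose distinguished triangles $w_{\le m}M\to M\to w_{\ge m+1}M\to$ with $w_{\le m}M\in\mathcal{C}_{w\le m}$, $w_{\ge m+1}M\in\mathcal{C}_{w\ge m+1}$; for $m<n$ there are unique morphisms of such triangles over $\mathrm{id}_M$ from the $m$-th one to the $n$-th one, giving $w_{\le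 m}M\to w_{\le n}M$ and $w_{\ge m+1}M\to w_{\ge n+1}M$. For a cohomological functor $H$ from $\mathcal{C}$ into an abelian category, the virtual $t$-truncations are the cohomological functors $\tau^{\ge -n}(H)(M)=\mathrm{Im}(H(w_{\le n+1}M)\to H(w_{\le n}M))$ and $\tau^{\le -n}(H)(M)=\mathrm{Im}(H(w_{\ge n}M)\to H(w_{\ge n-1}M))$, $n\in\mathbb{Z}$ (they do not depend on choices). An $R$-linear cohomological functor $H$ from $\mathcal{C}$ into $R$-modules is of $R$-finite type if for every $M\in\mathrm{Obj}\,\mathcal{C}$ the $R$-module $H(M)$ is finitely generated and $H(M[i])=0$ for almost all $i\in\mathbb{Z}$. $\mathcal{C}$ is $R$-saturated if the representable functors from $\mathcal{C}$ are exactly all the functors of $R$-finite type. $\mathrm{AddFun}_R(C,D)$ is the category of $R$-linear functors from $C$ to $D$; $R\text{-}\mathrm{mod}$ is the category of finitely generated $R$-modules. ''Embeds'' means: via a fully faithful functor. *)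

(* Defs.v *)
From HB Require Import structures.
From mathcomp Require Import all_boot all_order all_algebra.
From mathcomp Require Import boolp.
From mathcomp Require Import prodnormedzmodule.

Set Implicit Arguments.
Unset Strict Implicit.
Unset Printing Implicit Defensive.

Import Order.TTheory GRing.Theory Num.Theory.
Local Open Scope ring_scope.

Section Modules.
Variable R : comPzRingType.

Definition fin_gen (V : lmodType R) : Prop :=
  exists (n : nat) (v : 'I_n -> V), forall x : V,
    exists c : 'I_n -> R, x = \sum_(i < n) c i *: v i.

Definition noetherian : Prop :=
  forall I : {pred R}, 0 \in I ->
    (forall x y, x \in I -> y \in I -> x + y \in I) ->
    (forall a x, x \in I -> a * x \in I) ->
  exists (n : nat) (g : 'I_n -> R), (forall i, g i \in I) /\
    forall x, x \in I -> exists c : 'I_n -> R, x = \sum_(i < n) c i * g i.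

Lemma linear_ext (U V : lmodType R) (f g : {linear U -> V}) : f =1 g -> f = g.
Proof.
case: f g => [f cf] [g cg] /= /funext fg; subst g; congr (GRing.Linear.Pack _).
case: cf cg => [[p1] [p2]] [[q1] [q2]].
by rewrite (Prop_irrelevance p1 q1) (Prop_irrelevance p2 q2).
Qed.

Section LinearMaps.
Variables U V : lmodType R.
Implicit Types f g h : {linear U -> V}.

Definition lin0 : {linear U -> V} := \0.
Definition linN f : {linear U -> V} := \- f.
Definition linD f g : {linear U -> V} := f \+ g.
Definition linZ (a : R) f : {linear U -> V} := a \*: f.

Fact linDA : associative linD.
Proof. by move=> f g h; apply: linear_ext => x /=; rewrite addrA. Qed.
Fact linDC : commutative linD.
Proof. by move=> f g; apply: linear_ext => x /=; rewrite addrC. Qed.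
Fact lin0D : left_id lin0 linD.
Proof. by move=> f; apply: linear_ext => x /=; rewrite add0r. Qed.
Fact linND : left_inverse lin0 linN linD.
Proof. by move=> f; apply: linear_ext => x /=; rewrite addNr. Qed.
HB.instance Definition _ :=
  GRing.isZmodule.Build {linear U -> V} linDA linDC lin0D linND.

Fact linZA a b f : linZ a (linZ b f) = linZ (a * b) f.
Proof. by apply: linear_ext => x /=; rewrite scalerA. Qed.
Fact lin1Z : left_id 1 linZ.
Proof. by move=> f; apply: linear_ext => x /=; rewrite scale1r. Qed.
Fact linZDr : right_distributive linZ +%R.
Proof. by move=> a f g; apply: linear_ext => x /=; rewrite scalerDr. Qed.
Fact linZDl f : {morph linZ^~ f : a b / a + b}.
Proof. by move=> a b; apply: linear_ext => x /=; rewrite scalerDl. Qed.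
HB.instance Definition _ :=
  GRing.Zmodule_isLmodule.Build R {linear U -> V} linZA lin1Z linZDr linZDl.

Definition im_pred f : {pred V} := fun v => `[< exists u, f u = v >].

Fact im_pred_closed f : GRing.submod_closed (im_pred f).
Proof.
split; first by apply/asboolP; exists 0; rewrite linear0.
move=> a _ _ /asboolP[u <-] /asboolP[v <-].
by apply/asboolP; exists (a *: u + v); rewrite linearP.
Qed.
End LinearMaps.
End Modules.

Section ImageModule.
Variables (R : comPzRingType) (U V : lmodType R) (f : {linear U -> V}).

HB.instance Definition _ :=
  GRing.isSubmodClosed.Build R V (im_pred f) (im_pred_closed f).

Record imMod := ImMod { im_val : V; _ : im_val \in im_pred f }.
HB.instance Definition _ := [isSub for im_val].
HB.instance Definition _ := [Choice of imMod by <:].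
HB.instance Definition _ := [SubChoice_isSubLmodule of imMod by <:].
End ImageModule.

Section ImageMap.
Variables (R : comPzRingType) (U V U' V' : lmodType R).
Variables (f : {linear U -> V}) (f' : {linear U' -> V'}).
Variables (a : {linear V -> V'}) (b : {linear U -> U'}).
Hypothesis ab : forall u, a (f u) = f' (b u).

Fact im_map_subproof (x : imMod f) : a (im_val x) \in im_pred f'.
Proof.
case: x => x /= /asboolP[u <-]; apply/asboolP; exists (b u).
by rewrite ab.
Qed.

Definition im_map_fun (x : imMod f) : imMod f' := ImMod (im_map_subproof x).

Fact im_map_linear : linear im_map_fun.
Proof. by move=> c x y; apply: val_inj; rewrite /= !linearP. Qed.

HB.instance Definition _ :=
  GRing.isLinear.Build R (imMod f) (imMod f') *:%R im_map_fun im_map_linear.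

Definition im_map : {linear imMod f -> imMod f'} := im_map_fun.
End ImageMap.

Record category := Category {
  obj :> Type;
  hom : obj -> obj -> Type;
  idm : forall X, hom X X;
  comp : forall X Y Z, hom Y Z -> hom X Y -> hom X Z;
  compA : forall W X Y Z (f : hom W X) (g : hom X Y) (h : hom Y Z),
    comp h (comp g f) = comp (comp h g) f;
  comp1m : forall X Y (f : hom X Y), comp (idm Y) f = f;
  compm1 : forall X Y (f : hom X Y), comp f (idm X) = f }.

Definition is_iso (C : category) (X Y : C) (f : hom X Y) : Prop :=
  exists g : hom Y X, comp g f = idm X /\ comp f g = idm Y.

Definition isomorphic (C : category) (X Y : C) : Prop :=
  exists f : hom X Y, is_iso f.

Definition retract_of (C : category) (Y X : C) : Prop :=
  exists (i : hom Y X) (p : hom X Y), comp p i = idm Y.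

Record functor (C D : category) := Functor {
  fobj :> C -> D;
  fmap : forall X Y, hom X Y -> hom (fobj X) (fobj Y);
  fmap1 : forall X, fmap (idm X) = idm (fobj X);
  fmapM : forall X Y Z (f : hom X Y) (g : hom Y Z),
    fmap (comp g f) = comp (fmap g) (fmap f) }.

Definition fully_faithful (C D : category) (F : functor C D) : Prop :=
  forall X Y : C, bijective (@fmap C D F X Y).

Definition essentially_surjective (C D : category) (F : functor C D) : Prop :=
  forall Y : D, exists X : C, isomorphic (F X) Y.

Record linCat (R : comPzRingType) := LinCat {
  lobj :> Type;
  lhom : lobj -> lobj -> lmodType R;
  lid : forall X, lhom X X;
  lcomp : forall X Y Z, lhom Y Z -> lhom X Y -> lhom X Z;
  lcompA : forall W X Y Z (f : lhom W X) (g : lhom X Y) (h : lhom Y Z),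
    lcomp h (lcomp g f) = lcomp (lcomp h g) f;
  lcomp1m : forall X Y (f : lhom X Y), lcomp (lid Y) f = f;
  lcompm1 : forall X Y (f : lhom X Y), lcomp f (lid X) = f;
  lcompPl : forall X Y Z (f : lhom X Y),
    linear (fun g : lhom Y Z => lcomp g f);
  lcompPr : forall X Y Z (g : lhom Y Z),
    linear (fun f : lhom X Y => lcomp g f) }.

Declare Scope lincat_scope.
Delimit Scope lincat_scope with LC.
Notation "g ∘ f" := (lcomp g f)
  (at level 40, left associativity) : lincat_scope.
Open Scope lincat_scope.

Coercion catOf (R : comPzRingType) (C : linCat R) : category :=
  @Category (lobj C) (fun X Y => lhom X Y) (@lid R C) (@lcomp R C)
    (@lcompA R C) (@lcomp1m R C) (@lcompm1 R C).

Section LinCatTheory.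
Variables (R : comPzRingType) (C : linCat R).
Implicit Types X Y Z : C.

Definition lcompl X Y Z (f : lhom X Y) : lhom Y Z -> lhom X Z :=
  fun g => g ∘ f.
HB.instance Definition _ X Y Z (f : lhom X Y) :=
  GRing.isLinear.Build R (lhom Y Z) (lhom X Z) *:%R (lcompl f) (@lcompPl R C X Y Z f).
Definition lcompr X Y Z (g : lhom Y Z) : lhom X Y -> lhom X Z :=
  fun f => g ∘ f.
HB.instance Definition _ X Y Z (g : lhom Y Z) :=
  GRing.isLinear.Build R (lhom X Y) (lhom X Z) *:%R (lcompr g) (@lcompPr R C X Y Z g).

Lemma lcompDm X Y Z (f f' : lhom Y Z) (g : lhom X Y) :
  (f + f') ∘ g = f ∘ g + f' ∘ g.
Proof. exact: (linearD (lcompl g)). Qed.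
Lemma lcompZm X Y Z a (f : lhom Y Z) (g : lhom X Y) :
  (a *: f) ∘ g = a *: (f ∘ g).
Proof. exact: (linearZZ (lcompl g)). Qed.
Lemma lcompNm X Y Z (f : lhom Y Z) (g : lhom X Y) : (- f) ∘ g = - (f ∘ g).
Proof. exact: (linearN (lcompl g)). Qed.
Lemma lcompBm X Y Z (f f' : lhom Y Z) (g : lhom X Y) :
  (f - f') ∘ g = f ∘ g - f' ∘ g.
Proof. exact: (linearB (lcompl g)). Qed.
Lemma lcomp0m X Y Z (g : lhom X Y) : (0 : lhom Y Z) ∘ g = 0.
Proof. exact: (linear0 (lcompl g)). Qed.
Lemma lcompmD X Y Z (f : lhom Y Z) (g g' : lhom X Y) :
  f ∘ (g + g') = f ∘ g + f ∘ g'.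
Proof. exact: (linearD (lcompr f)). Qed.
Lemma lcompmZ X Y Z a (f : lhom Y Z) (g : lhom X Y) :
  f ∘ (a *: g) = a *: (f ∘ g).
Proof. exact: (linearZZ (lcompr f)). Qed.
Lemma lcompmN X Y Z (f : lhom Y Z) (g : lhom X Y) : f ∘ (- g) = - (f ∘ g).
Proof. exact: (linearN (lcompr f)). Qed.
Lemma lcompmB X Y Z (f : lhom Y Z) (g g' : lhom X Y) :
  f ∘ (g - g') = f ∘ g - f ∘ g'.
Proof. exact: (linearB (lcompr f)). Qed.
Lemma lcompm0 X Y Z (f : lhom Y Z) : f ∘ (0 : lhom X Y) = 0.
Proof. exact: (linear0 (lcompr f)). Qed.

Definition is_zero X : Prop := lid X = 0.

(* p1 ∘ i2 = 0 and p2 ∘ i1 = 0 follow *)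
Definition is_biproduct X Y P : Prop :=
  exists (i1 : lhom X P) (i2 : lhom Y P) (p1 : lhom P X) (p2 : lhom P Y),
  [/\ p1 ∘ i1 = lid X, p2 ∘ i2 = lid Y & i1 ∘ p1 + i2 ∘ p2 = lid P].

End LinCatTheory.

Record linFunctor (R : comPzRingType) (C D : linCat R) := LinFunctor {
  lfobj :> C -> D;
  lfmap : forall X Y, {linear lhom X Y -> lhom (lfobj X) (lfobj Y)};
  lfmap1 : forall X, lfmap X X (lid X) = lid (lfobj X);
  lfmapM : forall X Y Z (f : lhom X Y) (g : lhom Y Z),
    lfmap X Z (g ∘ f) = lfmap Y Z g ∘ lfmap X Y f }.
Arguments lfmap {R C D} F {X Y} : rename.

Record natTrans (R : comPzRingType) (C D : linCat R) (F G : linFunctor C D) :=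
  NatTrans {
  ntc :> forall X : C, lhom (F X) (G X);
  nt_natural : forall X Y (f : lhom X Y),
    ntc Y ∘ lfmap F f = lfmap G f ∘ ntc X }.

Section AddFun.
Variables (R : comPzRingType) (C D : linCat R).
Implicit Types F G H K : linFunctor C D.

Lemma natTrans_ext F G (a b : natTrans F G) : (forall X, a X = b X) -> a = b.
Proof.
case: a b => [a na] [b nb] /= ab.
have {}ab : a = b by apply: functional_extensionality_dep.
by subst b; rewrite (Prop_irrelevance na nb).
Qed.

Fact nt_id_subproof F X Y (f : lhom X Y) :
  lid (F Y) ∘ lfmap F f = lfmap F f ∘ lid (F X).
Proof. by rewrite lcomp1m lcompm1. Qed.
Definition nt_id F : natTrans F F := NatTrans (@nt_id_subproof F).

Fact nt_comp_subproof F G H (b : natTrans G H) (a : natTrans F G)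
    X Y (f : lhom X Y) :
  (b Y ∘ a Y) ∘ lfmap F f = lfmap H f ∘ (b X ∘ a X).
Proof. by rewrite -lcompA nt_natural lcompA nt_natural lcompA. Qed.
Definition nt_comp F G H (b : natTrans G H) (a : natTrans F G) :
  natTrans F H := NatTrans (nt_comp_subproof b a).

Fact nt_compA F G H K (a : natTrans F G) (b : natTrans G H)
  (c : natTrans H K) : nt_comp c (nt_comp b a) = nt_comp (nt_comp c b) a.
Proof. by apply: natTrans_ext => X /=; rewrite lcompA. Qed.
Fact nt_comp1m F G (a : natTrans F G) : nt_comp (nt_id G) a = a.
Proof. by apply: natTrans_ext => X /=; rewrite lcomp1m. Qed.
Fact nt_compm1 F G (a : natTrans F G) : nt_comp a (nt_id F) = a.
Proof. by apply: natTrans_ext => X /=; rewrite lcompm1. Qed.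

Definition AddFun : category := Category nt_compA nt_comp1m nt_compm1.

End AddFun.

Section LinCatConstructions.
Variable R : comPzRingType.

Section Functors.
Variables C D E : linCat R.

Definition idF : linFunctor C C :=
  @LinFunctor R C C (fun X => X) (fun X Y => (idfun : {linear lhom X Y -> lhom X Y}))
    (fun X => erefl) (fun X Y Z f g => erefl).

Variables (G : linFunctor D E) (F : linFunctor C D).
Fact compF1 X : lfmap G (lfmap F (lid X)) = lid (G (F X)).
Proof. by rewrite !lfmap1. Qed.
Fact compFM X Y Z (f : lhom X Y) (g : lhom Y Z) :
  lfmap G (lfmap F (g ∘ f)) = lfmap G (lfmap F g) ∘ lfmap G (lfmap F f).
Proof. by rewrite !lfmapM. Qed.
Definition compF : linFunctor C E :=
  @LinFunctor R C E (fun X => G (F X))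
    (fun X Y => (lfmap G \o lfmap F : {linear lhom X Y -> lhom (G (F X)) (G (F Y))}))
    compF1 compFM.
End Functors.

Definition op (C : linCat R) : linCat R :=
  @LinCat R (lobj C) (fun X Y => lhom Y X) (@lid R C)
    (fun X Y Z g f => f ∘ g)
    (fun W X Y Z f g h => esym (lcompA h g f))
    (fun X Y f => lcompm1 f) (fun X Y f => lcomp1m f)
    (fun X Y Z f => lcompPr f) (fun X Y Z g => lcompPl g).

Definition fullsub (C : linCat R) (P : C -> Prop) : linCat R :=
  @LinCat R {X : C | P X} (fun X Y => lhom (sval X) (sval Y))
    (fun X => lid (sval X)) (fun X Y Z g f => g ∘ f)
    (fun W X Y Z f g h => lcompA f g h)
    (fun X Y f => lcomp1m f) (fun X Y f => lcompm1 f)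
    (fun X Y Z f => lcompPl f) (fun X Y Z g => lcompPr g).

Fact mod_compA (T U V W : lmodType R) (f : {linear T -> U})
    (g : {linear U -> V}) (h : {linear V -> W}) :
  (h \o (g \o f : {linear T -> V}) : {linear T -> W})
  = ((h \o g : {linear U -> W}) \o f : {linear T -> W}).
Proof. exact: linear_ext. Qed.
Fact mod_comp1m (U V : lmodType R) (f : {linear U -> V}) :
  ((idfun : {linear V -> V}) \o f : {linear U -> V}) = f.
Proof. exact: linear_ext. Qed.
Fact mod_compm1 (U V : lmodType R) (f : {linear U -> V}) :
  (f \o (idfun : {linear U -> U}) : {linear U -> V}) = f.
Proof. exact: linear_ext. Qed.
Fact mod_compPl (U V W : lmodType R) (f : {linear U -> V}) :
  linear (fun g : {linear V -> W} => (g \o f : {linear U -> W})).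
Proof. by move=> a g h; apply: linear_ext => x. Qed.
Fact mod_compPr (U V W : lmodType R) (g : {linear V -> W}) :
  linear (fun f : {linear U -> V} => (g \o f : {linear U -> W})).
Proof. by move=> a f h; apply: linear_ext => x /=; rewrite linearP. Qed.

Definition modCat : linCat R :=
  @LinCat R (lmodType R) (fun U V => {linear U -> V})
    (fun U => (idfun : {linear U -> U}))
    (fun U V W g f => (g \o f : {linear U -> W}))
    mod_compA mod_comp1m mod_compm1 mod_compPl mod_compPr.

Definition fgMod : linCat R := @fullsub modCat (@fin_gen R).

End LinCatConstructions.

(* The shift [1] is an R-linear auto-equivalence [sh] with a chosen
   quasi-inverse [shV]; strict automorphisms are the special case where the
   two natural isomorphisms are identities.  [dist f g h] says that
   X --f--> Y --g--> Z --h--> X[1] is a distinguished triangle. *)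
Record triCat (R : comPzRingType) := TriCat {
  tcat :> linCat R;
  zero_exists : exists Z : tcat, is_zero Z;
  biproduct_exists : forall X Y : tcat, exists P, is_biproduct X Y P;
  sh : linFunctor tcat tcat;
  shV : linFunctor tcat tcat;
  sh_shV : @isomorphic (AddFun tcat tcat) (compF sh shV) (idF tcat);
  shV_sh : @isomorphic (AddFun tcat tcat) (compF shV sh) (idF tcat);
  dist : forall X Y Z : tcat, lhom X Y -> lhom Y Z -> lhom Z (sh X) -> Prop;
  dist_iso : forall (X Y Z X' Y' Z' : tcat)
    (f : lhom X Y) (g : lhom Y Z) (h : lhom Z (sh X))
    (f' : lhom X' Y') (g' : lhom Y' Z') (h' : lhom Z' (sh X'))
    (a : lhom X X') (b : lhom Y Y') (c : lhom Z Z'),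
    @is_iso tcat X X' a -> @is_iso tcat Y Y' b -> @is_iso tcat Z Z' c ->
    b ∘ f = f' ∘ a -> c ∘ g = g' ∘ b -> lfmap sh a ∘ h = h' ∘ c ->
    dist f g h -> dist f' g' h';
  dist_id : forall X Z : tcat, is_zero Z ->
    dist (lid X) (0 : lhom X Z) (0 : lhom Z (sh X));
  dist_cone : forall (X Y : tcat) (f : lhom X Y),
    exists (Z : tcat) (g : lhom Y Z) (h : lhom Z (sh X)), dist f g h;
  dist_rot : forall (X Y Z : tcat)
    (f : lhom X Y) (g : lhom Y Z) (h : lhom Z (sh X)),
    dist f g h <-> dist g h (- lfmap sh f);
  dist_mor : forall (X Y Z X' Y' Z' : tcat)
    (f : lhom X Y) (g : lhom Y Z) (h : lhom Z (sh X))
    (f' : lhom X' Y') (g' : lhom Y' Z') (h' : lhom Z' (sh X'))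
    (a : lhom X X') (b : lhom Y Y'),
    dist f g h -> dist f' g' h' -> b ∘ f = f' ∘ a ->
    exists c : lhom Z Z', c ∘ g = g' ∘ b /\ lfmap sh a ∘ h = h' ∘ c;
  dist_oct : forall (X Y Z U V W : tcat)
    (f : lhom X Y) (i : lhom Y U) (i' : lhom U (sh X))
    (g : lhom Y Z) (j : lhom Z W) (j' : lhom W (sh Y))
    (k : lhom Z V) (k' : lhom V (sh X)),
    dist f i i' -> dist g j j' -> dist (g ∘ f) k k' ->
    exists (u : lhom U V) (v : lhom V W),
    [/\ dist u v (lfmap sh i ∘ j'), u ∘ i = k ∘ g, k' ∘ u = i',
        v ∘ k = j & j' ∘ v = lfmap sh f ∘ k'] }.
Arguments sh {R} t.
Arguments shV {R} t.

(* M[i]; recall that [Negz n] is -(n+1) *)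
Definition shift (R : comPzRingType) (C : triCat R) (i : int) (M : C) : C :=
  match i with
  | Posz n => iter n (sh C) M
  | Negz n => iter n.+1 (shV C) M
  end.

(* The class P[i].  It is closed under isomorphisms by definition, since the
   shift is only an auto-equivalence; for a strict shift and an
   isomorphism-closed P this is the literal class of all Y[i] with P Y. *)
Definition shifted (R : comPzRingType) (C : triCat R) (P : C -> Prop) (i : int)
    (X : C) : Prop :=
  exists2 Y : C, P Y & @isomorphic C X (shift i Y).

Record weightStr (R : comPzRingType) (C : triCat R) := WeightStr {
  wle0 : C -> Prop;
  wge0 : C -> Prop;
  wle0_retract : forall X Y : C, wle0 X -> @retract_of C Y X -> wle0 Y;
  wge0_retract : forall X Y : C, wge0 X -> @retract_of C Y X -> wge0 Y;
  wle0_shift : forall X, wle0 X -> shifted wle0 1 X;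
  wge0_shift : forall X, shifted wge0 1 X -> wge0 X;
  w_orth : forall X Y, wle0 X -> shifted wge0 1 Y ->
    forall f : lhom X Y, f = 0;
  w_dec : forall M, exists (L N : C) (f : lhom L M) (g : lhom M N)
    (h : lhom N (sh C L)), [/\ dist f g h, wle0 L & shifted wge0 1 N] }.

Record tStr (R : comPzRingType) (C : triCat R) := TStr {
  tle0 : C -> Prop;
  tge0 : C -> Prop;
  tle0_iso : forall X Y : C, tle0 X -> @isomorphic C X Y -> tle0 Y;
  tge0_iso : forall X Y : C, tge0 X -> @isomorphic C X Y -> tge0 Y;
  tle0_shift : forall X, shifted tle0 1 X -> tle0 X;
  tge0_shift : forall X, tge0 X -> shifted tge0 1 X;
  t_orth : forall X Y, shifted tle0 1 X -> tge0 Y ->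
    forall f : lhom X Y, f = 0;
  t_dec : forall M, exists (L N : C) (f : lhom L M) (g : lhom M N)
    (h : lhom N (sh C L)), [/\ dist f g h, tle0 L & shifted tge0 (-1) N] }.

Section WeightDefs.
Variables (R : comPzRingType) (C : triCat R) (w : weightStr C).

Definition wle (i : int) : C -> Prop := shifted (wle0 w) i.
Definition wge (i : int) : C -> Prop := shifted (wge0 w) i.

Definition w_bounded : Prop :=
  (forall X, exists i, wle i X) /\ (forall X, exists i, wge i X).

Definition wHeart : linCat R := fullsub (fun X : C => wle0 w X /\ wge0 w X).

Definition tHeart (t : tStr C) : linCat R :=
  fullsub (fun X : C => tle0 t X /\ tge0 t X).

Definition right_adjacent (t : tStr C) : Prop :=
  forall X, tle0 t X <-> wge0 w X.

(* A triangle  w_{<=m} M -> M -> w_{>=m+1} M -> (w_{<=m} M)[1];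
   note the index m+1 of the third vertex *)
Record wDec (m : int) (M : C) := WDec {
  wd_le : C;
  wd_ge : C;
  wd_i : lhom wd_le M;
  wd_p : lhom M wd_ge;
  wd_d : lhom wd_ge (sh C wd_le);
  wd_dist : dist wd_i wd_p wd_d;
  wd_leP : wle m wd_le;
  wd_geP : wge (m + 1) wd_ge }.

End WeightDefs.

Section IsoTheory.
Variables (R : comPzRingType) (C : linCat R).
Implicit Types X Y Z : C.

Lemma iso_refl X : @isomorphic C X X.
Proof. by exists (lid X), (lid X); rewrite /= lcomp1m. Qed.
Lemma iso_sym X Y : @isomorphic C X Y -> @isomorphic C Y X.
Proof. by case=> f [g [gf fg]]; exists g, f. Qed.
Lemma iso_trans X Y Z :
  @isomorphic C X Y -> @isomorphic C Y Z -> @isomorphic C X Z.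
Proof.
case=> f [f' /= [f'f ff']] [g [g' /= [g'g gg']]].
exists (g ∘ f), (f' ∘ g') => /=; split.
  by rewrite lcompA -(lcompA g) g'g lcompm1.
by rewrite lcompA -(lcompA f') ff' lcompm1.
Qed.
Lemma iso_fun (F : linFunctor C C) X Y :
  @isomorphic C X Y -> @isomorphic C (F X) (F Y).
Proof.
case=> f [g /= [gf fg]]; exists (lfmap F f), (lfmap F g) => /=.
by rewrite -!lfmapM gf fg !lfmap1.
Qed.
Lemma iso_retract X Y : @isomorphic C X Y -> @retract_of C Y X.
Proof. by case=> f [g [gf fg]]; exists g, f. Qed.
End IsoTheory.

Section TriTheory.
Variables (R : comPzRingType) (C : triCat R).
Implicit Types X Y Z : C.

Lemma iso_sh_shV X : @isomorphic C (sh C (shV C X)) X.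
Proof.
case: (sh_shV C) => a [b [/= ba ab]]; exists (a X), (b X) => /=.
by split; [have := congr1 (fun t => ntc t X) ba | have := congr1 (fun t => ntc t X) ab].
Qed.
Lemma iso_shV_sh X : @isomorphic C (shV C (sh C X)) X.
Proof.
case: (shV_sh C) => a [b [/= ba ab]]; exists (a X), (b X) => /=.
by split; [have := congr1 (fun t => ntc t X) ba | have := congr1 (fun t => ntc t X) ab].
Qed.

Lemma sh_faithful X Y : injective (@lfmap R C C (sh C) X Y).
Proof.
move=> f g fg; case: (shV_sh C) => a [b [/= ba ab]].
have bX : b X ∘ a X = lid _ by have := congr1 (fun t => ntc t X) ba.
have aX Z : a Z ∘ b Z = lid _ by have := congr1 (fun t => ntc t Z) ab.
have nat Z T (k : lhom Z T) : k = a T ∘ lfmap (shV C) (lfmap (sh C) k) ∘ b Z.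
  by rewrite (nt_natural a k) /= -lcompA aX lcompm1.
by rewrite (nat _ _ f) (nat _ _ g) fg.
Qed.

Lemma shV_faithful X Y : injective (@lfmap R C C (shV C) X Y).
Proof.
move=> f g fg; case: (sh_shV C) => a [b [/= ba ab]].
have aX Z : a Z ∘ b Z = lid _ by have := congr1 (fun t => ntc t Z) ab.
have nat Z T (k : lhom Z T) : k = a T ∘ lfmap (sh C) (lfmap (shV C) k) ∘ b Z.
  by rewrite (nt_natural a k) /= -lcompA aX lcompm1.
by rewrite (nat _ _ f) (nat _ _ g) fg.
Qed.

Lemma sh_full X Y (k : lhom (sh C X) (sh C Y)) : exists f, lfmap (sh C) f = k.
Proof.
case: (shV_sh C) => a [b [/= ba ab]].
have bX Z : b Z ∘ a Z = lid _ by have := congr1 (fun t => ntc t Z) ba.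
have aX Z : a Z ∘ b Z = lid _ by have := congr1 (fun t => ntc t Z) ab.
exists (a Y ∘ lfmap (shV C) k ∘ b X); apply: shV_faithful.
have nat Z T (f : lhom Z T) : lfmap (shV C) (lfmap (sh C) f) = b T ∘ f ∘ a Z.
  by rewrite -lcompA -(nt_natural a f) lcompA bX lcomp1m.
by rewrite nat !lcompA bX lcomp1m -lcompA bX lcompm1.
Qed.

Lemma shiftS m X : @isomorphic C (shift (m + 1) X) (sh C (shift m X)).
Proof.
case: m => n; first by rewrite -PoszD addn1; apply: iso_refl.
case: n => [|n]; first exact: iso_sym (iso_sh_shV _).
have -> : Negz n.+1 + 1 = Negz n.
  by rewrite !NegzE -[n.+2]addn1 PoszD opprD addrNK.
exact: iso_sym (iso_sh_shV _).
Qed.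

Lemma shift_sh m X : @isomorphic C (shift m (sh C X)) (sh C (shift m X)).
Proof.
case: m => n /=; first by rewrite -iterSr; apply: iso_refl.
rewrite -!iterS.
elim: n.+1 => [|k IH]; first exact: iso_refl.
rewrite iterS; apply: iso_trans (iso_fun _ IH) _.
exact: iso_trans (iso_shV_sh _) (iso_sym (iso_sh_shV _)).
Qed.

Lemma iso_iter (F : linFunctor C C) n X Y :
  @isomorphic C X Y -> @isomorphic C (iter n F X) (iter n F Y).
Proof. by move=> XY; elim: n => //= n; apply: iso_fun. Qed.

Lemma shift_iso m X Y :
  @isomorphic C X Y -> @isomorphic C (shift m X) (shift m Y).
Proof. by move=> XY; case: m => n; apply: iso_iter. Qed.

Lemma shifted_iso P m X Y :
  shifted P m X -> @isomorphic C X Y -> shifted P m Y.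
Proof. by case=> Z PZ XZ XY; exists Z => //; apply: iso_trans (iso_sym XY) XZ. Qed.

Lemma shifted_sh P m X : shifted P m X -> shifted P (m + 1) (sh C X).
Proof.
case=> Z PZ XZ; exists Z => //.
exact: iso_trans (iso_fun _ XZ) (iso_sym (shiftS _ _)).
Qed.

Lemma shifted_shV P m X : shifted P (m + 1) X -> shifted P m (shV C X).
Proof.
case=> Z PZ XZ; exists Z => //.
apply: iso_trans (iso_fun _ XZ) _; apply: iso_trans (iso_fun _ (shiftS _ _)) _.
exact: iso_shV_sh.
Qed.

Lemma dist_comp0 X Y Z (f : lhom X Y) (g : lhom Y Z) h :
  dist f g h -> g ∘ f = 0.
Proof.
move=> fgh; have [O O0] := zero_exists C.
have [c [cg _]] := dist_mor (a := lid X) (b := f) (dist_id X O0) fgh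
  (f_equal2 _ (erefl _) (erefl _)).
by rewrite -cg lcompm0.
Qed.

Lemma dist_liftR X Y Z W (f : lhom X Y) (g : lhom Y Z) h (u : lhom Y W) :
  dist f g h -> u ∘ f = 0 -> exists v : lhom Z W, v ∘ g = u.
Proof.
move=> fgh uf; have [O O0] := zero_exists C.
have shO : is_zero (sh C O) by rewrite /is_zero -lfmap1 O0 linear0.
have d0 : dist (0 : lhom O W) (lid W) (0 : lhom W (sh C O)).
  by apply/dist_rot; rewrite linear0 oppr0; apply: dist_id.
have [|c [cg _]] := @dist_mor R C _ _ _ _ _ _ _ _ _ _ _ _ 0 u fgh d0.
  by rewrite uf lcompm0.
by exists c; rewrite cg lcomp1m.
Qed.

Lemma dist_liftL X Y Z W (f : lhom X Y) (g : lhom Y Z) h (u : lhom W Y) :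
  dist f g h -> g ∘ u = 0 -> exists v : lhom W X, f ∘ v = u.
Proof.
move=> fgh gu; have [O O0] := zero_exists C.
have d0 := dist_id W O0; move/dist_rot in d0; move/dist_rot in (fgh).
have [|c [_ cg]] := @dist_mor R C _ _ _ _ _ _ _ _ _ _ _ _ u (0 : lhom O Z) d0 fgh.
  by rewrite gu lcompm0.
have [v vc] := sh_full c; exists v; apply: sh_faithful.
rewrite lfmapM vc; apply: oppr_inj.
by rewrite -lcompNm -cg lfmap1 lcompmN lcompm1.
Qed.

Lemma dist_sh X Y Z (f : lhom X Y) (g : lhom Y Z) h :
  dist f g h <-> dist (lfmap (sh C) f) (lfmap (sh C) g) (- lfmap (sh C) h).
Proof.
have -> : dist f g h <->
    dist (- lfmap (sh C) f) (- lfmap (sh C) g) (- lfmap (sh C) h).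
  by rewrite dist_rot dist_rot dist_rot.
have isoN T : @is_iso C T T (- lid T).
  by exists (- lid T); rewrite /= lcompNm lcomp1m opprK.
have iso1 T : @is_iso C T T (lid T) by exists (lid T); rewrite /= lcomp1m.
split; apply: (dist_iso (isoN _) (iso1 _) (isoN _));
  by rewrite ?linearN ?lfmap1 ?lcompNm ?lcompmN ?lcomp1m ?lcompm1 ?opprK.
Qed.

Lemma hom_shV_eq0 X Y :
  (forall f : lhom (shV C X) (shV C Y), f = 0) -> forall f : lhom X Y, f = 0.
Proof. by move=> f0 f; apply: shV_faithful; rewrite linear0. Qed.

Lemma hom_sh_eq0 X Y :
  (forall f : lhom (sh C X) (sh C Y), f = 0) -> forall f : lhom X Y, f = 0.
Proof. by move=> f0 f; apply: sh_faithful; rewrite linear0. Qed.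

End TriTheory.

Section WeightTheory.
Variables (R : comPzRingType) (C : triCat R) (w : weightStr C).
Implicit Types (X Y M N : C) (m n : int).

Lemma int_updown_ind (P : int -> Prop) :
  P 0 -> (forall m, P m -> P (m + 1)) -> (forall m, P (m + 1) -> P m) ->
  forall m, P m.
Proof.
move=> P0 Pup Pdown m; elim/int_ind: m => [//|n IH|n IH].
  by rewrite -addn1 PoszD; apply: Pup.
by apply: Pdown; rewrite -[n.+1]addn1 PoszD opprD addrNK.
Qed.

Lemma wleS m X : wle w m X -> wle w (m + 1) X.
Proof.
case=> Y /wle0_shift[Z Z0 YZ] XY; exists Z => //.
apply: iso_trans XY _; apply: iso_trans (shift_iso _ YZ) _.
exact: iso_trans (shift_sh _ _) (iso_sym (shiftS _ _)).
Qed.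

Lemma wgeS m X : wge w (m + 1) X -> wge w m X.
Proof.
case=> Y Y0 XY; exists (sh C Y).
  by apply: wge0_shift; exists Y => //; apply: iso_refl.
apply: iso_trans XY _.
exact: iso_trans (shiftS _ _) (iso_sym (shift_sh _ _)).
Qed.

Lemma wge_mono m n X : m <= n -> wge w n X -> wge w m X.
Proof.
move=> mn; have [k ->] : exists k : nat, n = m + k%:Z.
  by exists `|n - m|%N; rewrite gez0_abs ?subr_ge0// [RHS]addrC subrK.
by elim: k => [|k IH]; rewrite ?addr0// -addn1 PoszD addrA => /wgeS.
Qed.

Lemma wle_wge0 m n X Y : m < n -> wle w m X -> wge w n Y ->
  forall f : lhom X Y, f = 0.
Proof.
rewrite -lezD1 => mn Xm /(wge_mono mn) {mn}; move: X Y Xm.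
elim/int_updown_ind: m => [|m IH|m IH] X Y Xm Ym.
- apply: (w_orth (w := w)); last by rewrite add0r in Ym.
  by case: Xm => Z Z0 XZ; apply: wle0_retract Z0 (iso_retract (iso_sym XZ)).
- by apply: hom_shV_eq0; apply: IH; apply: shifted_shV.
- by apply: hom_sh_eq0; apply: IH; apply: shifted_sh.
Qed.

Lemma wDec_exists m M : inhabited (wDec w m M).
Proof.
elim/int_updown_ind: m M => [|m IH|m IH] M.
- have [L [N [f [g [h [d L0 N1]]]]]] := w_dec w M.
  by do 2![econstructor]; [exact: d|exists L => //; apply: iso_refl|rewrite add0r].
- have [[L N f g h d Lm Nm]] := IH (shV C M).
  have [e [e' /= [e'e ee']]] := iso_sh_shV M.
  constructor; apply: (@WDec R C w _ M (sh C L) (sh C N)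
    (e ∘ lfmap (sh C) f) (lfmap (sh C) g ∘ e') (- lfmap (sh C) h)).
  + have iso1 T : @is_iso C T T (lid T) by exists (lid T); rewrite /= lcomp1m.
    have ise : @is_iso C _ _ e by exists e'.
    apply: dist_iso (iso1 _) ise (iso1 _) _ _ _ (proj1 (dist_sh _ _ _) d).
    * by rewrite lcompm1.
    * by rewrite -lcompA e'e lcompm1 lcomp1m.
    * by rewrite lfmap1 lcomp1m lcompm1.
  + exact: shifted_sh.
  + exact: shifted_sh.
- have [[L N f g h d Lm Nm]] := IH (sh C M).
  have [e [e' /= [e'e ee']]] := iso_sh_shV L.
  have [r [r' /= [r'r rr']]] := iso_sh_shV N.
  have [f' f'E] := sh_full (f ∘ e); have [g' g'E] := sh_full (r' ∘ g).
  have [h' h'E] := sh_full (- (lfmap (sh C) e' ∘ h ∘ r)).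
  constructor; apply: (@WDec R C w _ M (shV C L) (shV C N) f' g' h').
  + apply/dist_sh; rewrite f'E g'E h'E opprK.
    have iso1 T : @is_iso C T T (lid T) by exists (lid T); rewrite /= lcomp1m.
    have ise : @is_iso C _ _ e' by exists e.
    have isr : @is_iso C _ _ r' by exists r.
    apply: dist_iso ise (iso1 _) isr _ _ _ d.
    * by rewrite -lcompA ee' lcompm1 lcomp1m.
    * by rewrite lcompm1.
    * by rewrite -[RHS]lcompA rr' lcompm1.
  + exact: shifted_shV.
  + exact: shifted_shV.
Qed.

(* [ab] is a morphism, over [f], from the triangle [d] to the triangle [d'] *)
Definition wd_over m n M N (f : lhom M N) (d : wDec w m M) (d' : wDec w n N)
    (ab : lhom (wd_le d) (wd_le d') * lhom (wd_ge d) (wd_ge d')) : Prop :=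
  [/\ wd_i d' ∘ ab.1 = f ∘ wd_i d, ab.2 ∘ wd_p d = wd_p d' ∘ f
    & lfmap (sh C) ab.1 ∘ wd_d d = wd_d d' ∘ ab.2].
Arguments wd_over {m n M N} f d d' ab.

Lemma wd_over_exists m n M N (f : lhom M N) (d : wDec w m M) (d' : wDec w n N) :
  m <= n -> exists ab, wd_over f d d' ab.
Proof.
move=> mn; have mn1 : m < n + 1 by rewrite ltzD1.
have [|a aE] := dist_liftL (u := f ∘ wd_i d) (wd_dist d').
  exact: wle_wge0 mn1 (wd_leP d) (wd_geP d') _.
have [b [bE ab]] := dist_mor (wd_dist d) (wd_dist d') (esym aE).
by exists (a, b).
Qed.

Lemma wd_le_unique m n M N (d : wDec w m M) (d' : wDec w n N)
    (a a' : lhom (wd_le d) (wd_le d')) :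
  m < n -> wd_i d' ∘ a = wd_i d' ∘ a' -> a = a'.
Proof.
move=> mn aa'; apply/eqP; rewrite -subr_eq0; apply/eqP; apply: sh_faithful.
have [|v <-] := dist_liftL (u := lfmap (sh C) (a - a'))
    (proj1 (dist_rot _ _ _) (proj1 (dist_rot _ _ _) (wd_dist d'))).
  by rewrite lcompNm -lfmapM lcompmB aa' subrr linear0 oppr0.
suff -> : v = 0 by rewrite lcompm0 linear0.
apply: (@wle_wge0 (m + 1) (n + 1)); last exact: wd_geP.
  by rewrite ltrD2r.
exact: shifted_sh (wd_leP d).
Qed.

Lemma wd_ge_unique m n M N (d : wDec w m M) (d' : wDec w n N)
    (b b' : lhom (wd_ge d) (wd_ge d')) :
  m < n -> b ∘ wd_p d = b' ∘ wd_p d -> b = b'.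
Proof.
move=> mn bb'; apply/eqP; rewrite -subr_eq0; apply/eqP.
have [|v <-] := dist_liftR (u := b - b') (proj1 (dist_rot _ _ _) (wd_dist d)).
  by rewrite lcompBm bb' subrr.
suff -> : v = 0 by rewrite lcomp0m.
apply: (@wle_wge0 (m + 1) (n + 1)); last exact: wd_geP.
  by rewrite ltrD2r.
exact: shifted_sh (wd_leP d).
Qed.

Definition wd_mor m n M N (f : lhom M N) (d : wDec w m M) (d' : wDec w n N)
    (mn : m <= n) : lhom (wd_le d) (wd_le d') * lhom (wd_ge d) (wd_ge d') :=
  sval (cid (wd_over_exists f d d' mn)).

Lemma wd_morP m n M N (f : lhom M N) (d : wDec w m M) (d' : wDec w n N)
  (mn : m <= n) : wd_over f d d' (wd_mor f d d' mn).
Proof. exact: svalP (cid _). Qed.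

End WeightTheory.

Section ImageFunctor.
Variables (R : comPzRingType) (C : linCat R).

(* Morphisms [ap_c M : A M -> B M] where A, B are only functorial up to the
   indeterminacy killed by [ap_c]; this is what is needed for
   M |-> Im (H (B M) -> H (A M)) to be a functor. *)
Record approx := Approx {
  ap_A : C -> C;
  ap_B : C -> C;
  ap_c : forall M, lhom (ap_A M) (ap_B M);
  ap_a : forall M N, lhom M N -> lhom (ap_A M) (ap_A N);
  ap_b : forall M N, lhom M N -> lhom (ap_B M) (ap_B N);
  ap_comm : forall M N (f : lhom M N), ap_c N ∘ ap_a f = ap_b f ∘ ap_c M;
  ap_lin : forall M N k (f g : lhom M N),
    ap_c N ∘ ap_a (k *: f + g) = k *: (ap_c N ∘ ap_a f) + ap_c N ∘ ap_a g;
  ap_id : forall M, ap_c M ∘ ap_a (lid M) = ap_c M;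
  ap_comp : forall M N P (f : lhom M N) (g : lhom N P),
    ap_c P ∘ ap_a (g ∘ f) = ap_c P ∘ ap_a g ∘ ap_a f }.

Variables (T : approx) (H : linFunctor (op C) (modCat R)).

Definition pull (F : linFunctor (op C) (modCat R)) (X Y : C) (f : lhom X Y) :
  {linear (F Y : lmodType R) -> (F X : lmodType R)} :=
  @lfmap R (op C) (modCat R) F Y X f.

Lemma pull1 F (X : C) x : pull F (lid X) x = x.
Proof. by rewrite /pull (lfmap1 F X). Qed.
Lemma pullM F (X Y Z : C) (f : lhom X Y) (g : lhom Y Z) x :
  pull F (g ∘ f) x = pull F f (pull F g x).
Proof. by rewrite /pull (@lfmapM R (op C) (modCat R) F Z Y X g f). Qed.
Lemma pullP F (X Y : C) k (f g : lhom X Y) x :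
  pull F (k *: f + g) x = k *: pull F f x + pull F g x.
Proof. by rewrite /pull linearP. Qed.

Fact imF_subproof (M N : C) (f : lhom M N) u :
  pull H (ap_a T f) (pull H (ap_c T N) u) = pull H (ap_c T M) (pull H (ap_b T f) u).
Proof. by rewrite -!pullM ap_comm. Qed.

Definition imF_obj (M : op C) : modCat R := imMod (pull H (ap_c T M)).

Definition imF_map (M N : op C) (f : lhom M N) : lhom (imF_obj M) (imF_obj N) :=
  im_map (imF_subproof (f : @lhom R C N M)).

Fact imF_linear M N : linear (@imF_map M N).
Proof.
move=> k f g; apply: linear_ext => -[x xP]; apply: val_inj => /=.
by case/asboolP: (xP) => u <-; rewrite -!pullM ap_lin pullP.
Qed.
HB.instance Definition _ M N := GRing.isLinear.Build R
  (lhom M N) (lhom (imF_obj M) (imF_obj N)) *:%R (@imF_map M N) (@imF_linear M N).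

Fact imF_map1 M : imF_map (lid M) = lid (imF_obj M).
Proof.
apply: linear_ext => -[x xP]; apply: val_inj => /=.
by case/asboolP: (xP) => u <-; rewrite -!pullM ap_id.
Qed.

Fact imF_mapM M N P (f : lhom M N) (g : lhom N P) :
  imF_map (g ∘ f) = imF_map g ∘ imF_map f.
Proof.
apply: linear_ext => -[x xP]; apply: val_inj => /=.
by case/asboolP: (xP) => u <-; rewrite -!pullM ap_comp lcompA.
Qed.

Definition imF : linFunctor (op C) (modCat R) :=
  @LinFunctor R (op C) (modCat R) imF_obj (fun M N => @imF_map M N)
    imF_map1 imF_mapM.

End ImageFunctor.

Section VirtualTruncations.
Variables (R : comPzRingType) (C : triCat R) (w : weightStr C).
Implicit Types (M N P : C) (m n : int).

(* A simultaneous choice of the triangles for all m and M; the virtual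
   truncations below are defined for an arbitrary such choice. *)
Definition wDecs : Type := forall (m : int) (M : C), wDec w m M.

Lemma wDecs_exists : inhabited wDecs.
Proof.
have D m M : {d : wDec w m M | True}.
  by apply: cid; have [d] := wDec_exists w m M; exists d.
by exists => m M; exact: sval (D m M).
Qed.

Variable D : wDecs.

(* [wle_conn] and [wge_conn] are the two components of the unique morphism of
   triangles over id_M, see [wd_le_unique] and [wd_ge_unique]. *)
Definition wle_conn m n (mn : m < n) M :
    lhom (wd_le (D m M)) (wd_le (D n M)) :=
  (wd_mor (lid M) (D m M) (D n M) (ltW mn)).1.
Definition wge_conn m n (mn : m < n) M :
    lhom (wd_ge (D m M)) (wd_ge (D n M)) :=
  (wd_mor (lid M) (D m M) (D n M) (ltW mn)).2.

Lemma wle_connE m n (mn : m < n) M :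
  wd_i (D n M) ∘ wle_conn mn M = wd_i (D m M).
Proof. by case: (wd_morP (lid M) (D m M) (D n M) (ltW mn)) => ->; rewrite lcomp1m. Qed.
Lemma wge_connE m n (mn : m < n) M :
  wge_conn mn M ∘ wd_p (D m M) = wd_p (D n M).
Proof. by case: (wd_morP (lid M) (D m M) (D n M) (ltW mn)) => _ ->; rewrite lcompm1. Qed.

(* For a general f the two components below are only chosen, and become
   independent of the choice after composing with the connecting morphism. *)
Definition wle_map m M N (f : lhom M N) :
    lhom (wd_le (D m M)) (wd_le (D m N)) :=
  (wd_mor f (D m M) (D m N) (lexx m)).1.
Definition wge_map m M N (f : lhom M N) :
    lhom (wd_ge (D m M)) (wd_ge (D m N)) :=
  (wd_mor f (D m M) (D m N) (lexx m)).2.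

Lemma wle_mapE m M N (f : lhom M N) :
  wd_i (D m N) ∘ wle_map m f = f ∘ wd_i (D m M).
Proof. by case: (wd_morP f (D m M) (D m N) (lexx m)). Qed.
Lemma wge_mapE m M N (f : lhom M N) :
  wge_map m f ∘ wd_p (D m M) = wd_p (D m N) ∘ f.
Proof. by case: (wd_morP f (D m M) (D m N) (lexx m)). Qed.

Section Approximations.
Variables (m n : int) (mn : m < n).

Fact wle_comm M N (f : lhom M N) :
  wle_conn mn N ∘ wle_map m f = wle_map n f ∘ wle_conn mn M.
Proof.
apply: (wd_le_unique mn); rewrite !lcompA wle_connE !wle_mapE.
by rewrite -lcompA wle_connE.
Qed.
Fact wle_lin M N k (f g : lhom M N) :
  wle_conn mn N ∘ wle_map m (k *: f + g)
  = k *: (wle_conn mn N ∘ wle_map m f) + wle_conn mn N ∘ wle_map m g.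
Proof.
apply: (wd_le_unique mn); rewrite lcompmD lcompmZ !lcompA wle_connE !wle_mapE.
by rewrite lcompDm lcompZm.
Qed.
Fact wle_id M : wle_conn mn M ∘ wle_map m (lid M) = wle_conn mn M.
Proof.
apply: (wd_le_unique mn).
by rewrite !lcompA wle_connE wle_mapE lcomp1m.
Qed.
Fact wle_comp M N P (f : lhom M N) (g : lhom N P) :
  wle_conn mn P ∘ wle_map m (g ∘ f)
  = wle_conn mn P ∘ wle_map m g ∘ wle_map m f.
Proof.
apply: (wd_le_unique mn); rewrite !lcompA wle_connE !wle_mapE.
by rewrite -!lcompA wle_mapE.
Qed.
Definition wle_approx : approx C :=
  Approx wle_comm wle_lin wle_id wle_comp.

Fact wge_comm M N (f : lhom M N) :
  wge_conn mn N ∘ wge_map m f = wge_map n f ∘ wge_conn mn M.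
Proof.
apply: (wd_ge_unique mn); rewrite -!lcompA wge_connE !wge_mapE.
by rewrite lcompA wge_connE.
Qed.
Fact wge_lin M N k (f g : lhom M N) :
  wge_conn mn N ∘ wge_map m (k *: f + g)
  = k *: (wge_conn mn N ∘ wge_map m f) + wge_conn mn N ∘ wge_map m g.
Proof.
apply: (wd_ge_unique mn).
by rewrite lcompDm lcompZm -!lcompA !wge_mapE !lcompmD !lcompmZ.
Qed.
Fact wge_id M : wge_conn mn M ∘ wge_map m (lid M) = wge_conn mn M.
Proof.
apply: (wd_ge_unique mn).
by rewrite -!lcompA wge_mapE lcompm1.
Qed.
Fact wge_comp M N P (f : lhom M N) (g : lhom N P) :
  wge_conn mn P ∘ wge_map m (g ∘ f)
  = wge_conn mn P ∘ wge_map m g ∘ wge_map m f.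
Proof.
apply: (wd_ge_unique mn); rewrite -!lcompA !wge_mapE.
by rewrite [wge_map m g ∘ _]lcompA wge_mapE !lcompA.
Qed.
Definition wge_approx : approx C :=
  Approx wge_comm wge_lin wge_id wge_comp.
End Approximations.

Fact ltD1 n : n < n + 1. Proof. by rewrite ltrDl. Qed.
Fact ltB2B1 n : n - 2 < n - 1. Proof. by rewrite ltrD2l. Qed.

Variable H : linFunctor (op C) (modCat R).

(* tau^{>= -n} H : M |-> Im (H (w_{<=n+1} M) -> H (w_{<=n} M)) *)
Definition tau_geN (n : int) : linFunctor (op C) (modCat R) :=
  imF (wle_approx (ltD1 n)) H.

(* tau^{<= -n} H : M |-> Im (H (w_{>=n} M) -> H (w_{>=n-1} M)), where
   w_{>=n} M is the third vertex of the (n-1)-st triangle *)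
Definition tau_leN (n : int) : linFunctor (op C) (modCat R) :=
  imF (wge_approx (ltB2B1 n)) H.

End VirtualTruncations.

Section Yoneda.
Variables (R : comPzRingType) (C : linCat R).

Definition yo_map (N : C) (X Y : op C) (f : lhom X Y) :
    @lhom R (modCat R) (@lhom R C X N) (@lhom R C Y N) :=
  (@lcompl R C Y X N f : {linear @lhom R C X N -> @lhom R C Y N}).

Fact yo_linear (N : C) (X Y : op C) : linear (@yo_map N X Y).
Proof. by move=> k f g; apply: linear_ext => x /=; apply: lcompPr. Qed.
HB.instance Definition _ (N : C) (X Y : op C) := GRing.isLinear.Build R
  (lhom X Y) (@lhom R (modCat R) (@lhom R C X N) (@lhom R C Y N)) *:%R
  (@yo_map N X Y) (@yo_linear N X Y).

Fact yo_map1 (N : C) (X : op C) :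
  yo_map N (lid X) = @lid R (modCat R) (@lhom R C X N).
Proof. by apply: linear_ext => x /=; apply: lcompm1. Qed.
Fact yo_mapM (N : C) (X Y Z : op C) (f : lhom X Y) (g : lhom Y Z) :
  yo_map N (g ∘ f) = yo_map N g ∘ yo_map N f.
Proof. by apply: linear_ext => x; apply: (@lcompA R C _ _ _ _ g f x). Qed.

(* H_N = C(-, N) *)
Definition yoneda (N : C) : linFunctor (op C) (modCat R) :=
  @LinFunctor R (op C) (modCat R) (fun X => @lhom R C X N)
    (fun X Y => @yo_map N X Y) (@yo_map1 N) (@yo_mapM N).

Definition representable (H : linFunctor (op C) (modCat R)) : Prop :=
  exists N : C, @isomorphic (AddFun (op C) (modCat R)) H (yoneda N).

Definition postcomp (N N' : C) (phi : lhom N N') (X : C) :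
    {linear lhom X N -> lhom X N'} := lcompr phi.

Fact postcomp_natural (N N' : C) (phi : lhom N N') (X Y : op C)
    (f : lhom X Y) :
  @lcomp R (modCat R) _ _ _ (postcomp phi Y) (lfmap (yoneda N) f)
  = @lcomp R (modCat R) _ _ _ (lfmap (yoneda N') f) (postcomp phi X).
Proof. by apply: linear_ext => x /=; apply: lcompA. Qed.

(* N |-> C(-,N)|_P as a functor from the full subcategory on Q to
   AddFun_R(P^op, R-mod); finite generation of the Hom modules is what makes
   the values land in R-mod. *)
Section RestrictedYoneda.
Hypothesis fgC : forall X N : C, fin_gen (lhom X N).
Variables P Q : C -> Prop.

Definition ryo_obj (N : fullsub Q) : linFunctor (op (fullsub P)) (fgMod R) :=
  @LinFunctor R (op (fullsub P)) (fgMod R)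
    (fun X => exist (@fin_gen R) (@lhom R C (sval X) (sval N))
                    (fgC (sval X) (sval N)))
    (fun X Y => @lfmap R (op C) (modCat R) (yoneda (sval N)) (sval X) (sval Y))
    (fun X => lfmap1 (yoneda (sval N)) (sval X))
    (fun X Y Z f g => @lfmapM R (op C) (modCat R) (yoneda (sval N))
                        (sval X) (sval Y) (sval Z) f g).

Definition ryo_map (N N' : fullsub Q) (phi : lhom N N') :
    natTrans (ryo_obj N) (ryo_obj N') :=
  @NatTrans R (op (fullsub P)) (fgMod R) (ryo_obj N) (ryo_obj N')
    (fun X => @postcomp (sval N) (sval N') phi (sval X))
    (fun X Y f => @postcomp_natural (sval N) (sval N') phi (sval X) (sval Y) f).

Fact ryo_map1 (N : fullsub Q) : ryo_map (lid N) = nt_id (ryo_obj N).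
Proof.
apply: natTrans_ext => X; apply: linear_ext => x /=.
exact: (@lcomp1m R C).
Qed.
Fact ryo_mapM (N N' N'' : fullsub Q) (f : lhom N N') (g : lhom N' N'') :
  ryo_map (g ∘ f) = nt_comp (ryo_map g) (ryo_map f).
Proof.
apply: natTrans_ext => X; apply: linear_ext => x /=.
exact: esym (@lcompA R C _ _ _ _ _ _ _).
Qed.

Definition ryo : functor (fullsub Q) (AddFun (op (fullsub P)) (fgMod R)) :=
  @Functor (fullsub Q) (AddFun (op (fullsub P)) (fgMod R))
    ryo_obj ryo_map ryo_map1 ryo_mapM.
End RestrictedYoneda.

End Yoneda.

Section Saturated.
Variables (R : comPzRingType) (C : triCat R).

Definition cohomological (H : linFunctor (op C) (modCat R)) : Prop :=
  forall (X Y Z : C) (f : lhom X Y) (g : lhom Y Z) (h : lhom Z (sh C X)),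
    dist f g h ->
    forall y, pull H f y = 0 <-> exists z, pull H g z = y.

Definition finite_type (H : linFunctor (op C) (modCat R)) : Prop :=
  [/\ cohomological H, forall M : C, fin_gen (H M)
    & forall M : C, exists s : seq int, forall i, i \notin s ->
        forall x : (H (shift i M) : lmodType R), x = 0].

Definition saturated : Prop :=
  forall H : linFunctor (op C) (modCat R), representable H <-> finite_type H.

Lemma saturated_fin_gen : saturated -> forall X N : C, fin_gen (lhom X N).
Proof.
move=> sat X N; have [] : finite_type (yoneda (N : tcat C)).
  by apply/sat; exists N; exists (nt_id _), (nt_id _); rewrite /= nt_comp1m.
by move=> _ /(_ X).
Qed.

Definition heart_embedding (w : weightStr C) (t : tStr C) (sat : saturated) :
    functor (tHeart t) (AddFun (op (wHeart w)) (fgMod R)) :=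
  ryo (saturated_fin_gen sat) (fun X : C => wle0 w X /\ wge0 w X)
    (fun X : C => tle0 t X /\ tge0 t X).

End Saturated.

(* Main.v *)
Require Import Defs.
From HB Require Import structures.
From mathcomp Require Import all_boot all_order all_algebra.
From mathcomp Require Import boolp zify.

(** Write i : w_{<=n} M -> M and p : M -> w_{>=n} M for the truncations.

    Orthogonality identifies tau^{>= -n}(H)(M) with the elements x of
    H(w_{<=n} M) such that b^* x = 0 for all b : A -> w_{<=n} M with A of
    weight <= n and i b = 0. These elements amount to the natural
    transformations from C(-, M) to H on the objects of weight <= n, so
    tau^{>= -n}(H) is the right Kan extension of the restriction of H to these
    objects. Such an extension is cohomological as soon as the restricted
    functor is exact on triangles of objects of weight <= n
    ([kan_cohomological]): a triangle X -> Y -> Z is approximated by a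
    triangle w_{<=n} X -> K -> w_{<=n} Z. Dually, tau^{<= -n}(H)(M) is
    H(w_{>=n} M) modulo the elements e^* q, for e : w_{>=n} M -> Q with Q of
    weight >= n and e p = 0, and [tau_le_cohomological] extends elements along
    cones of weight >= n. The values are images of finitely generated modules,
    and for a bounded weight structure almost all shifts of M have weights so
    large or so small that the truncation vanishes there, at once or together
    with H.

    If C is saturated, the truncations of H_M are thus representable. An
    object L representing tau^{<= 0} H_M has weight >= 0, and the cone of L ->
    M is right orthogonal to the objects of weight >= 0 ([wge0_approximation],
    [adjacent_dec]). This is the truncation triangle of the adjacent
    t-structure, whose coaisle is the right orthogonal of the objects of
    weight >= 1.

    An object N of weight >= 0 has a presentation B -> A -> N by objects of
    the heart of w, with A = w_{<=0} N. It is right exact for morphisms from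
    that heart and left exact for morphisms to the coaisle
    ([heart_presentation]), which gives full faithfulness.

    For essential surjectivity, a functor Phi on the heart of w is extended to
    C in two steps: by a left Kan extension to the objects A of weight <= 0,
    where the value is Phi(w_{>=0} A) modulo the elements e^* q, for e :
    w_{>=0} A -> Q with Q in the heart and e p = 0, and then by a right Kan
    extension to C. The first extension is exact on triangles of objects of
    weight <= 0 ([lan_exact]), so the result is cohomological. It vanishes on
    the objects of weight >= 1 and on those of weight <= -1, and its values
    are subquotients of values of Phi, hence finitely generated over a
    noetherian ring. So it is represented by some N, which lies in the heart
    of t because of these two vanishing properties. *)

Set Implicit Arguments.
Unset Strict Implicit.
Unset Printing Implicit Defensive.

Import Order.TTheory GRing.Theory Num.Theory.
Local Open Scope ring_scope.

(** * Modules *)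

(** A submodule as a structured additive subgroup, the form in which quotients
    of additive groups take it. *)
Definition submod_zmod (R : comPzRingType) (V : lmodType R) (S : V -> bool)
    (S_closed : GRing.submod_closed S) : zmodClosed V :=
  HB.pack_for (zmodClosed V) S
    (GRing.isZmodClosed.Build V S (GRing.submod_closedB S_closed)).

Section QuotientModule.
Local Open Scope quotient_scope.
Variables (R : comPzRingType) (V : lmodType R) (S : V -> bool).
Hypothesis S_closed : GRing.submod_closed S.
Local Notation submodS := (submod_zmod S_closed).

(** The quotient V / S of a module by a submodule, on top of the quotient
    of additive groups. *)
Definition quotMod : Type := Quotient.quot submodS.
HB.instance Definition _ := GRing.Zmodule.on quotMod.

(** The projection V -> V / S. *)
Definition quotP : V -> quotMod := \pi_(Quotient.quot submodS).

Lemma quotP_surj (u : quotMod) : exists x, quotP x = u.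
Proof. by exists (repr (u : Quotient.quot submodS)); apply: reprK. Qed.

Lemma quotP_eq x y : quotP x = quotP y <-> x - y \in S.
Proof.
split=> [/eqP|xy].
  by move=> xy; have := Quotient.idealrBE submodS x y; rewrite /quotP in xy; rewrite xy.
by apply/eqP; have := Quotient.idealrBE submodS x y; rewrite /quotP => <-.
Qed.

Fact quotP_add x y : quotP (x + y) = quotP x + quotP y.
Proof. by rewrite /quotP; apply: (raddfD (\pi_(Quotient.quot submodS))). Qed.

Definition quot_scale (a : R) (u : quotMod) : quotMod :=
  quotP (a *: repr (u : Quotient.quot submodS)).

Fact quot_scaleE a x : quot_scale a (quotP x) = quotP (a *: x).
Proof.
apply/quotP_eq; rewrite -scalerBr -[_ *: _]addr0; apply: S_closed.2 S_closed.1.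
by apply/quotP_eq; apply: reprK.
Qed.

Fact quot_scaleA a b u : quot_scale a (quot_scale b u) = quot_scale (a * b) u.
Proof. by have [x <-] := quotP_surj u; rewrite !quot_scaleE scalerA. Qed.
Fact quot_scale1 : left_id 1 quot_scale.
Proof. by move=> u; have [x <-] := quotP_surj u; rewrite quot_scaleE scale1r. Qed.
Fact quot_scaleDr : right_distributive quot_scale +%R.
Proof.
move=> a u v; have [x <-] := quotP_surj u; have [y <-] := quotP_surj v.
by rewrite -quotP_add !quot_scaleE scalerDr quotP_add.
Qed.
Fact quot_scaleDl u : {morph quot_scale^~ u : a b / a + b}.
Proof.
by move=> a b; have [x <-] := quotP_surj u; rewrite !quot_scaleE scalerDl quotP_add.
Qed.
HB.instance Definition _ := GRing.Zmodule_isLmodule.Build R quotMod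
  quot_scaleA quot_scale1 quot_scaleDr quot_scaleDl.

Fact quotP_linear : linear quotP.
Proof. by move=> a x y; rewrite quotP_add -quot_scaleE. Qed.
HB.instance Definition _ := GRing.isLinear.Build R V quotMod *:%R quotP quotP_linear.

Lemma quotP_eq0 x : quotP x = 0 <-> x \in S.
Proof. by rewrite -[0](linear0 quotP) quotP_eq subr0. Qed.
End QuotientModule.

Section QuotientMap.
Variables (R : comPzRingType) (V V' : lmodType R) (S : V -> bool) (S' : V' -> bool).
Hypotheses (cS : GRing.submod_closed S) (cS' : GRing.submod_closed S').
Variable f : {linear V -> V'}.
Hypothesis fS : forall x, x \in S -> f x \in S'.

Definition quot_map_fun (u : quotMod cS) : quotMod cS' :=
  quotP cS' (f (sval (cid (quotP_surj u)))).

Lemma quot_mapE x : quot_map_fun (quotP cS x) = quotP cS' (f x).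
Proof.
apply/quotP_eq; rewrite -linearB; apply: fS; apply/(quotP_eq cS).
exact: svalP (cid (quotP_surj _)).
Qed.

Fact quot_map_linear : linear quot_map_fun.
Proof.
move=> a u v; have [x <-] := quotP_surj u; have [y <-] := quotP_surj v.
by rewrite -linearP !quot_mapE !linearP.
Qed.
HB.instance Definition _ := GRing.isLinear.Build R
  (quotMod cS) (quotMod cS') *:%R quot_map_fun quot_map_linear.

(** The map V / S -> V' / S' induced by f. *)
Definition quot_map : {linear quotMod cS -> quotMod cS'} := quot_map_fun.
End QuotientMap.

Lemma inj_surj_bijective (S T : Type) (f : S -> T) :
  injective f -> (forall y, exists x, f x = y) -> bijective f.
Proof.
move=> f_inj f_surj; exists (fun y => sval (cid (f_surj y))) => x.
  exact: f_inj (svalP (cid (f_surj (f x)))).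
exact: svalP (cid (f_surj x)).
Qed.

Lemma linear_inverse (R : comPzRingType) (U V : lmodType R) (f : {linear U -> V}) :
  injective f -> (forall y, exists x, f x = y) ->
  exists g : {linear V -> U}, cancel f g /\ cancel g f.
Proof.
move=> f_inj f_surj; have [g fK gK] := inj_surj_bijective f_inj f_surj.
have g_lin : linear g by move=> a x y; apply: f_inj; rewrite linearP !gK.
pose mixin := GRing.isLinear.Build R V U *:%R g g_lin.
by exists (HB.pack_for {linear V -> U} g mixin).
Qed.

Section FiniteGeneration.
Variable R : comPzRingType.

(** x is a linear combination of the elements of the list s. *)
Fixpoint spanned (V : lmodType R) (s : seq V) (x : V) : Prop :=
  if s is v :: s' then exists c : R, spanned s' (x - c *: v) else x = 0.

Section Spanned.
Variable V : lmodType R.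
Implicit Types (s : seq V) (x y : V).

Lemma spanned_mkseq n (v : nat -> V) x :
  spanned (mkseq v n) x <-> exists c : nat -> R, x = \sum_(i < n) c i *: v i.
Proof.
rewrite /mkseq; have E m k : iota m k = [seq (m + i)%N | i <- iota 0 k].
  by rewrite -iotaDl addn0.
elim: n v x => [|n IH] v x /=.
  by split=> [->|[c ->]]; [exists (fun=> 0) |]; rewrite big_ord0.
rewrite (E 1%N) -map_comp; split=> [[a /(IH (v \o S))[c xE]]|[c ->]].
  exists (fun i => if i is j.+1 then c j else a).
  by rewrite big_ord_recl -xE addrC subrK.
exists (c 0%N); apply/(IH (v \o S)); exists (c \o S).
by rewrite big_ord_recl addrC addKr.
Qed.

Lemma fin_genP : fin_gen V <-> exists s, forall x, spanned s x.
Proof.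
split=> [[n [v vP]]|[s sP]].
  exists (mkseq (fun i => if insub i is Some j then v j else 0) n) => x.
  apply/spanned_mkseq; have [c ->] := vP x.
  exists (fun i => if insub i is Some j then c j else 0).
  by apply: eq_bigr => i _; rewrite valK.
exists (size s), (fun i => s`_i) => x.
have := sP x; rewrite -[X in spanned X](mkseq_nth 0) => /spanned_mkseq[c ->].
by exists (fun i => c i).
Qed.

Lemma spanned0 s : spanned s 0.
Proof. by elim: s => //= v s IH; exists 0; rewrite scale0r subr0. Qed.

Lemma spannedP s a x y : spanned s x -> spanned s y -> spanned s (a *: x + y).
Proof.
elim: s x y => /= [x y -> ->|v s IH x y [c cx] [d dy]]; first by rewrite scaler0 addr0.
exists (a * c + d); have := IH _ _ cx dy.
by rewrite scalerBr scalerDl scalerA addrACA -opprD.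
Qed.

Lemma spanned_cat s t x y : spanned s x -> spanned t y -> spanned (s ++ t) (x + y).
Proof.
elim: s x => /= [x ->|v s IH x [c cx] ty]; first by rewrite add0r.
by exists c; rewrite addrAC; apply: IH.
Qed.
End Spanned.

Lemma spanned_map (U V : lmodType R) (f : {linear U -> V}) s x :
  spanned s x -> spanned (map f s) (f x).
Proof.
elim: s x => /= [x ->|v s IH x [c cx]]; first exact: linear0.
by exists c; rewrite -linearZ -linearB; apply: IH.
Qed.

Lemma fin_gen_quotient (U V : lmodType R) (f : {linear U -> V}) :
  (forall y, exists x, f x = y) -> fin_gen U -> fin_gen V.
Proof.
move=> f_surj /fin_genP[s sP]; apply/fin_genP; exists (map f s) => y.
by have [x <-] := f_surj y; apply: spanned_map.
Qed.

Hypothesis R_noeth : noetherian R.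

(** Induction on the number of generators: the leading coefficients of the
    elements of P with respect to the first generator form an ideal. *)
Lemma noetherian_subspan (V : lmodType R) (s : seq V) (P : V -> Prop) :
  P 0 -> (forall a x y, P x -> P y -> P (a *: x + y)) ->
  (forall x, P x -> spanned s x) ->
  exists t : seq V, (forall x, x \in t -> P x) /\ forall x, P x -> spanned t x.
Proof.
elim: s P => [|v s IH] P P0 PP Ps; first by exists [::].
pose I : {pred R} := fun c => `[< exists2 x, P x & spanned s (x - c *: v) >].
have IP a c d : c \in I -> d \in I -> a * c + d \in I.
  move=> /asboolP[x Px xc] /asboolP[y Py yd]; apply/asboolP.
  exists (a *: x + y); first exact: PP.
  by have := spannedP a xc yd; rewrite scalerBr scalerDl scalerA addrACA -opprD.
have I0 : 0 \in I.
  by apply/asboolP; exists 0; rewrite // scale0r subr0; apply: spanned0.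
have [|a c /(IP a)/(_ I0)|n [g [gI gP]]] := R_noeth I0.
- by move=> c d cI dI; rewrite -[c]mul1r; apply: IP.
- by rewrite addr0.
have [x_ xP] : exists x_ : 'I_n -> V,
    forall i, P (x_ i) /\ spanned s (x_ i - g i *: v).
  have H i : {x | P x /\ spanned s (x - g i *: v)}.
    by apply: cid; have /asboolP[x Px xg] := gI i; exists x.
  by exists (fun i => sval (H i)) => i; apply: svalP (H i).
have [||x [_ xs] //|t [tP tgen]] := IH (fun x => P x /\ spanned s x).
- by split=> //; apply: spanned0.
- by move=> a x y [Px xs] [Py ys]; split; [apply: PP|apply: spannedP].
exists (codom x_ ++ t); split=> [x|x Px].
  by rewrite mem_cat => /orP[/codomP[i ->]|/tP[]//]; case: (xP i).
have [c xc] := Ps x Px.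
have /gP[d cE] : c \in I by apply/asboolP; exists x.
pose y := \sum_(i < n) d i *: x_ i.
have [Py ys] : P y /\ spanned s (y - c *: v).
  rewrite /y cE scaler_suml -sumrB.
  apply: (big_ind2 (fun u w => P u /\ spanned s w)).
  - by split=> //; apply: spanned0.
  - move=> a b a' b' [Pa b1] [Pb b2]; split.
      by rewrite -[a]scale1r; apply: PP.
    by rewrite -[b]scale1r; apply: spannedP.
  - move=> i _; have [Pi si] := xP i; split.
      by rewrite -[_ *: _]addr0; apply: PP.
    rewrite -scalerA -scalerBr -[_ *: _]addr0.
    by apply: spannedP => //; apply: spanned0.
have -> : x = y + (x - y) by rewrite addrC subrK.
apply: spanned_cat; last first.
  apply: tgen; split; first by rewrite addrC -scaleN1r; apply: PP.
  have := spannedP (-1) ys xc.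
  by rewrite scaleN1r opprB addrC addrA subrK.
have -> : codom x_ = mkseq (fun i => if insub i is Some j then x_ j else 0) n.
  rewrite /mkseq -val_enum_ord -map_comp codomE; apply: eq_map => i /=.
  by rewrite valK.
apply/spanned_mkseq; exists (fun i => if insub i is Some j then d j else 0).
by apply: eq_bigr => i _; rewrite valK.
Qed.

Lemma noetherian_submodule (U V : lmodType R) (f : {linear U -> V}) :
  injective f -> fin_gen V -> fin_gen U.
Proof.
move=> f_inj /fin_genP[s sP].
have [||x _ //|t [tP tgen]] :=
    @noetherian_subspan V s (fun y => exists x, f x = y).
- by exists 0; rewrite linear0.
- by move=> a _ _ [x <-] [y <-]; exists (a *: x + y); rewrite linearP.
have [r rt] : exists r, map f r = t.
  elim: t tP {tgen} => [|y t IH] tP; first by exists [::].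
  have [x <-] := tP y (mem_head _ _).
  have [r <-] := IH (fun z zt => tP z (@mem_behead _ (y :: t) z zt)).
  by exists (x :: r).
apply/fin_genP; exists r => x.
have := tgen (f x) (ex_intro _ x erefl); rewrite -rt {tP tgen rt}.
elim: r x => /= [x|v r IH x [c]]; first by rewrite -(linear0 f) => /f_inj.
by rewrite -linearZ -linearB => /IH; exists c.
Qed.
End FiniteGeneration.

Section Images.
Variables (R : comPzRingType) (U V : lmodType R) (f : {linear U -> V}).

(** The image of f as a submodule of V, and as a quotient of U. *)
Definition im_incl : {linear imMod f -> V} := (val : imMod f -> V).

Lemma im_incl_inj : injective im_incl.
Proof. exact: val_inj. Qed.

Fact im_proj_subproof u : f u \in im_pred f.
Proof. by apply/asboolP; exists u. Qed.

Definition im_proj (u : U) : imMod f := ImMod (im_proj_subproof u).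

Fact im_proj_linear : linear im_proj.
Proof. by move=> a x y; apply: im_incl_inj; rewrite /= linearP. Qed.
HB.instance Definition _ := GRing.isLinear.Build R U (imMod f) *:%R im_proj im_proj_linear.

Lemma im_inclP x : exists u, im_incl x = f u.
Proof. by case: x => x fx; have /asboolP[u uE] := fx; exists u. Qed.

Lemma im_incl_ex u : exists x, im_incl x = f u.
Proof. by exists (im_proj u). Qed.

Lemma fin_gen_im : fin_gen U -> fin_gen (imMod f).
Proof.
apply: (fin_gen_quotient (f := im_proj)) => y; have [u yE] := im_inclP y.
by exists u; apply: im_incl_inj; rewrite /= -yE.
Qed.
End Images.

(** * Triangles and weights *)

Section Triangles.
Variables (R : comPzRingType) (C : triCat R).
Implicit Types X Y Z W : C.

Lemma lcomp_sub0 X Y Z (g : lhom Y Z) (a b : lhom X Y) :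
  (g ∘ (a - b) = 0) <-> (g ∘ a = g ∘ b).
Proof. by rewrite lcompmB; split=> [/eqP|->]; rewrite ?subr_eq0 ?subrr// => /eqP. Qed.

Lemma dist_inv_rot X Y Z (f : lhom X Y) (g : lhom Y Z) h :
  dist f g h -> dist h (- lfmap (sh C) f) (- lfmap (sh C) g).
Proof. by move=> /dist_rot/dist_rot. Qed.

Lemma dist_comp0_rot X Y Z (f : lhom X Y) (g : lhom Y Z) h : dist f g h -> h ∘ g = 0.
Proof. by move=> /dist_rot/dist_comp0. Qed.

Lemma dist_comp0_shift X Y Z (f : lhom X Y) (g : lhom Y Z) h :
  dist f g h -> lfmap (sh C) f ∘ h = 0.
Proof.
by move=> /dist_inv_rot/dist_comp0; rewrite lcompNm => /eqP; rewrite oppr_eq0 => /eqP.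
Qed.

(** Every morphism to a shift is the third morphism of a triangle, and every
    morphism is the second morphism of a triangle. *)
Lemma dist_cocone Z X (h : lhom Z (sh C X)) :
  exists Y (f : lhom X Y) (g : lhom Y Z), dist f g h.
Proof.
have [Q [u [v huv]]] := dist_cone h.
have [e [e' /= [e'e ee']]] := iso_sh_shV Q.
have [f fE] := sh_full (- (e' ∘ u)); have [g gE] := sh_full (- (v ∘ e)).
exists (shV C Q), f, g; apply/dist_rot/dist_rot; rewrite fE gE !opprK.
have iso1 T : @is_iso C T T (lid T) by exists (lid T); rewrite /= lcomp1m.
have ise : @is_iso C _ _ e' by exists e.
apply: dist_iso (iso1 _) (iso1 _) ise _ _ _ huv.
- by rewrite lcomp1m lcompm1.
- by rewrite lcompm1.
- by rewrite lfmap1 lcomp1m -lcompA ee' lcompm1.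
Qed.

Lemma dist_fiber Y Z (g : lhom Y Z) :
  exists X (f : lhom X Y) (h : lhom Z (sh C X)), dist f g h.
Proof.
have [Q [u [v guv]]] := dist_cone g.
have [e [e' /= [e'e ee']]] := iso_sh_shV Q.
have [f fE] := sh_full (- (v ∘ e)).
exists (shV C Q), f, (e' ∘ u); apply/dist_rot; rewrite fE opprK.
have iso1 T : @is_iso C T T (lid T) by exists (lid T); rewrite /= lcomp1m.
have ise : @is_iso C _ _ e' by exists e.
apply: dist_iso (iso1 _) (iso1 _) ise _ _ _ guv.
- by rewrite lcomp1m lcompm1.
- by rewrite lcompm1.
- by rewrite lfmap1 lcomp1m -lcompA ee' lcompm1.
Qed.

Lemma dist_mor_mid X Y Z X' Y' Z' (f : lhom X Y) (g : lhom Y Z) h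
    (f' : lhom X' Y') (g' : lhom Y' Z') h' (a : lhom X X') (c : lhom Z Z') :
  dist f g h -> dist f' g' h' -> lfmap (sh C) a ∘ h = h' ∘ c ->
  exists b, b ∘ f = f' ∘ a /\ c ∘ g = g' ∘ b.
Proof.
move=> /dist_inv_rot d /dist_inv_rot d' ac.
have [b' [b1 b2]] := dist_mor d d' ac.
have [b bE] := sh_full b'; exists b.
rewrite -bE in b1 b2.
split; apply: sh_faithful; rewrite !lfmapM.
  by apply: oppr_inj; rewrite -lcompmN b1 lcompNm.
by apply: oppr_inj; rewrite -lcompmN b2 lcompNm.
Qed.

Lemma dist_liftL_rot X Y Z W (f : lhom X Y) (g : lhom Y Z) h (u : lhom W Z) :
  dist f g h -> h ∘ u = 0 -> exists v : lhom W Y, g ∘ v = u.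
Proof. by move=> /dist_rot; apply: dist_liftL. Qed.

Lemma dist_liftL_sh X Y Z W (f : lhom X Y) (g : lhom Y Z) h (u : lhom W (sh C X)) :
  dist f g h -> lfmap (sh C) f ∘ u = 0 -> exists v : lhom W Z, h ∘ v = u.
Proof.
by move=> /dist_inv_rot d fu; apply: dist_liftL d _; rewrite lcompNm fu oppr0.
Qed.

Lemma dist_liftR_rot X Y Z W (f : lhom X Y) (g : lhom Y Z) h (u : lhom Z W) :
  dist f g h -> u ∘ g = 0 -> exists v : lhom (sh C X) W, v ∘ h = u.
Proof. by move=> /dist_rot; apply: dist_liftR. Qed.

(** The two mixed relations of a biproduct. *)
Lemma biproduct_cross X Y P (i1 : lhom X P) (i2 : lhom Y P) (p1 : lhom P X)
    (p2 : lhom P Y) :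
  p1 ∘ i1 = lid X -> p2 ∘ i2 = lid Y -> i1 ∘ p1 + i2 ∘ p2 = lid P ->
  p2 ∘ i1 = 0 /\ p1 ∘ i2 = 0.
Proof.
move=> e1 e2 e; split.
  apply: (addIr (p2 ∘ i1)); rewrite add0r -[in RHS](lcompm1 p2) -e lcompmD lcompDm.
  by rewrite -!lcompA e1 lcompm1 [p2 ∘ (i2 ∘ _)]lcompA e2 lcomp1m.
apply: (addIr (p1 ∘ i2)); rewrite add0r -[in RHS](lcompm1 p1) -e lcompmD lcompDm.
by rewrite -!lcompA e2 lcompm1 [p1 ∘ (i1 ∘ _)]lcompA e1 lcomp1m.
Qed.

Lemma retract_fun (F : linFunctor C C) X Y :
  @retract_of C X Y -> @retract_of C (F X) (F Y).
Proof.
case=> i [p /= pi]; exists (lfmap F i), (lfmap F p) => /=.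
by rewrite -lfmapM pi lfmap1.
Qed.

(** Every morphism into a shift is the shift of a morphism, up to an
    isomorphism of the source. *)
Lemma hom_into_sh X Y (f : lhom X (sh C Y)) :
  exists (e : lhom (sh C (shV C X)) X) (e' : lhom X (sh C (shV C X)))
    (g : lhom (shV C X) Y), e ∘ e' = lid X /\ f ∘ e = lfmap (sh C) g.
Proof.
have [e [e' /= [e'e ee']]] := iso_sh_shV X.
by have [g gE] := sh_full (f ∘ e); exists e, e', g.
Qed.

Lemma shifted_retract (P : C -> Prop) :
  (forall X Y, P X -> @retract_of C Y X -> P Y) ->
  forall m X Y, shifted P m X -> @retract_of C Y X -> shifted P m Y.
Proof.
move=> Pr m; elim/int_updown_ind: m => [|m IH|m IH] X Y PX YX.
- case: PX => Z PZ /iso_sym/iso_retract XZ; exists Y; last exact: iso_refl.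
  exact: Pr _ _ (Pr _ _ PZ XZ) YX.
- apply: shifted_iso (shifted_sh _) (iso_sh_shV Y).
  by apply: IH (shifted_shV PX) _; apply: retract_fun.
- apply: shifted_iso (shifted_shV _) (iso_shV_sh Y).
  by apply: IH (shifted_sh PX) _; apply: retract_fun.
Qed.

Lemma shifted_shift (P : C -> Prop) m X i :
  shifted P m X -> shifted P (m + i) (shift i X).
Proof.
move=> PX; elim/int_updown_ind: i => [|i IH|i IH]; first by rewrite addr0.
  by rewrite addrA; apply: shifted_iso (shifted_sh IH) (iso_sym (shiftS _ _)).
apply: shifted_iso (iso_shV_sh _); apply: shifted_shV.
by rewrite -addrA; apply: shifted_iso IH (shiftS _ _).
Qed.
End Triangles.

Section Weights.
Variables (R : comPzRingType) (C : triCat R) (w : weightStr C).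
Implicit Types (X Y Z M N A B : C) (m n : int).

Lemma wle0E X : wle w 0 X <-> wle0 w X.
Proof.
split=> [[Y Y0 XY]|X0]; last by exists X => //; apply: iso_refl.
exact: wle0_retract Y0 (iso_retract (iso_sym XY)).
Qed.

Lemma wge0E X : wge w 0 X <-> wge0 w X.
Proof.
split=> [[Y Y0 XY]|X0]; last by exists X => //; apply: iso_refl.
exact: wge0_retract Y0 (iso_retract (iso_sym XY)).
Qed.

Lemma wle_retract n X Y : wle w n X -> @retract_of C Y X -> wle w n Y.
Proof. by apply: shifted_retract; apply: wle0_retract. Qed.

Lemma wge_retract n X Y : wge w n X -> @retract_of C Y X -> wge w n Y.
Proof. by apply: shifted_retract; apply: wge0_retract. Qed.

Lemma wle_mono m n X : m <= n -> wle w m X -> wle w n X.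
Proof.
move=> mn; have [k ->] : exists k : nat, n = m + k%:Z.
  by exists `|n - m|%N; rewrite gez0_abs ?subr_ge0// [RHS]addrC subrK.
by elim: k => [|k IH]; rewrite ?addr0// -addn1 PoszD addrA => /IH/wleS.
Qed.

(** Each class of a weight structure is the orthogonal of the other one. *)
Lemma wle_orth n X :
  (forall Y, wge w (n + 1) Y -> forall f : lhom X Y, f = 0) -> wle w n X.
Proof.
move=> X0; have [d] := wDec_exists w n X.
have [|s sE] := dist_liftL (u := lid X) (wd_dist d).
  by rewrite (X0 _ (wd_geP d) (wd_p d)) lcomp0m.
by apply: wle_retract (wd_leP d) _; exists s, (wd_i d).
Qed.

Lemma wge_orth n Y :
  (forall X, wle w (n - 1) X -> forall f : lhom X Y, f = 0) -> wge w n Y.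
Proof.
move=> Y0; have [d] := wDec_exists w (n - 1) Y.
have [|s sE] := dist_liftR (u := lid Y) (wd_dist d).
  by rewrite (Y0 _ (wd_leP d) (wd_i d)) lcompm0.
have := wd_geP d; rewrite subrK => dP.
by apply: wge_retract dP _; exists (wd_p d), s.
Qed.

Lemma wle_of_sh n X : wle w (n + 1) (sh C X) -> wle w n X.
Proof. by move=> /shifted_shV Xn; apply: shifted_iso Xn (iso_shV_sh X). Qed.

Lemma hom_wle_wge n X Y : wle w n X -> wge w (n + 1) Y -> forall f : lhom X Y, f = 0.
Proof. by apply: wle_wge0; rewrite ltrDl. Qed.

Lemma wle_ext n X Y Z (f : lhom X Y) (g : lhom Y Z) h :
  dist f g h -> wle w n X -> wle w n Z -> wle w n Y.
Proof.
move=> d Xn Zn; apply: wle_orth => T Tn u.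
have [|v <-] := dist_liftR (u := u) d; first exact: hom_wle_wge Xn Tn _.
by rewrite (hom_wle_wge Zn Tn v) lcomp0m.
Qed.

Lemma wge_ext n X Y Z (f : lhom X Y) (g : lhom Y Z) h :
  dist f g h -> wge w n X -> wge w n Z -> wge w n Y.
Proof.
have nn : n - 1 < n by rewrite ltrBlDr ltrDl.
move=> d Xn Zn; apply: wge_orth => T Tn u.
have [|v <-] := dist_liftL (u := u) d; first exact: wle_wge0 nn Tn Zn _.
by rewrite (wle_wge0 nn Tn Xn v) lcompm0.
Qed.

Lemma wle_biproduct n X Y P : is_biproduct X Y P -> wle w n X -> wle w n Y -> wle w n P.
Proof.
case=> i1 [i2 [p1 [p2 [_ _ e]]]] Xn Yn; apply: wle_orth => T Tn u.
rewrite -(lcompm1 u) -e lcompmD !lcompA.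
by rewrite (hom_wle_wge Xn Tn (u ∘ i1)) (hom_wle_wge Yn Tn (u ∘ i2)) !lcomp0m addr0.
Qed.

Lemma wge_biproduct n X Y P : is_biproduct X Y P -> wge w n X -> wge w n Y -> wge w n P.
Proof.
have nn : n - 1 < n by rewrite ltrBlDr ltrDl.
case=> i1 [i2 [p1 [p2 [_ _ e]]]] Xn Yn; apply: wge_orth => T Tn u.
rewrite -(lcomp1m u) -e lcompDm -!lcompA.
by rewrite (wle_wge0 nn Tn Xn (p1 ∘ u)) (wle_wge0 nn Tn Yn (p2 ∘ u)) !lcompm0 addr0.
Qed.

(** A morphism from A to w_{<=n} M is determined by its composite to M if A has
    weight <= n - 1, and a morphism from w_{>=n+1} M to B is determined by its
    composite from M if B has weight >= n + 2. *)
Lemma wd_i_inj n M (d : wDec w n M) A (a : lhom A (wd_le d)) :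
  wle w (n - 1) A -> wd_i d ∘ a = 0 -> a = 0.
Proof.
move=> An ia; apply: sh_faithful; rewrite linear0.
have [|v <-] := dist_liftL_sh (u := lfmap (sh C) a) (wd_dist d).
  by rewrite -lfmapM ia linear0.
have An' : wle w n (sh C A) by rewrite -[n](subrK 1); apply: shifted_sh.
by rewrite (hom_wle_wge An' (wd_geP d) v) lcompm0.
Qed.

Lemma wd_p_inj n M (d : wDec w n M) B (b : lhom (wd_ge d) B) :
  wge w (n + 2) B -> b ∘ wd_p d = 0 -> b = 0.
Proof.
move=> Bn bp; have [v <-] := dist_liftR_rot (wd_dist d) bp.
have Bn' : wge w (n + 1 + 1) B by rewrite -addrA.
by rewrite (hom_wle_wge (shifted_sh (wd_leP d)) Bn' v) lcomp0m.
Qed.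

(** An object of weight <= n is a retract of its truncation w_{<=n}, and
    dually. *)
Lemma wd_i_split n M (d : wDec w n M) :
  wle w n M -> exists s : lhom M (wd_le d), wd_i d ∘ s = lid M.
Proof.
move=> Mn; apply: (dist_liftL (wd_dist d)).
by rewrite (hom_wle_wge Mn (wd_geP d) (wd_p d)) lcomp0m.
Qed.

Lemma wd_p_split n M (d : wDec w n M) :
  wge w (n + 1) M -> exists s : lhom (wd_ge d) M, s ∘ wd_p d = lid M.
Proof.
move=> Mn; apply: (dist_liftR (wd_dist d)).
by rewrite (hom_wle_wge (wd_leP d) Mn (wd_i d)) lcompm0.
Qed.

Lemma wd_i_lift n M (d : wDec w n M) A (a : lhom A M) :
  wle w n A -> exists a', wd_i d ∘ a' = a.
Proof.
by move=> An; apply: (dist_liftL (wd_dist d)); apply: hom_wle_wge An (wd_geP d) _.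
Qed.

Lemma wd_p_lift n M (d : wDec w n M) B (b : lhom M B) :
  wge w (n + 1) B -> exists b', b' ∘ wd_p d = b.
Proof.
by move=> Bn; apply: (dist_liftR (wd_dist d)); apply: hom_wle_wge (wd_leP d) Bn _.
Qed.

(** If m >= n + 1 and M has weight <= m, then so has w_{>=n+1} M, and dually. *)
Lemma wd_ge_wle n m M (d : wDec w n M) : n + 1 <= m -> wle w m M -> wle w m (wd_ge d).
Proof.
move=> nm Mm; apply: wle_ext (proj1 (dist_rot _ _ _) (wd_dist d)) Mm _.
exact: wle_mono nm (shifted_sh (wd_leP d)).
Qed.

Lemma wd_le_wge n m M (d : wDec w n M) : m <= n -> wge w m M -> wge w m (wd_le d).
Proof.
move=> mn Mm; apply: wge_orth => A Am u.
have [|v vE] := dist_liftL_sh (u := lfmap (sh C) u) (wd_dist d).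
  rewrite -lfmapM; have mm : m - 1 < m by rewrite ltrBlDr ltrDl.
  by rewrite (wle_wge0 mm Am Mm (wd_i d ∘ u)) linear0.
apply: sh_faithful; rewrite -vE linear0.
have Am' : wle w n (sh C A).
  by apply: wle_mono mn _; rewrite -[m](subrK 1); apply: shifted_sh.
by rewrite (hom_wle_wge Am' (wd_geP d) v) lcompm0.
Qed.

(** In a bounded weight structure, a property of all objects of sufficiently
    large and of sufficiently small weights holds for almost all shifts of
    each object. *)
Lemma bounded_almost_all (P : C -> Prop) a b :
  w_bounded w -> (forall X, wge w a X -> P X) -> (forall X, wle w b X -> P X) ->
  forall M, exists s : seq int, forall i, i \notin s -> P (shift i M).
Proof.
move=> [Wle Wge] Pa Pb M; have [m Mm] := Wle M; have [n Mn] := Wge M.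
exists [seq b - m + 1 + k%:Z | k <- iota 0 (absz (a - n - (b - m + 1))%R)] => i /mapP is_.
have [ai|ia] := leP a (n + i).
  by apply/Pa/(wge_mono ai); apply: shifted_shift.
have [ib|bi] := leP (m + i) b.
  by apply/Pb/(wle_mono ib); apply: shifted_shift.
case: is_; exists (absz (i - (b - m + 1))%R); last by lia.
by rewrite mem_iota; lia.
Qed.
End Weights.

(** * Right Kan extensions from objects of bounded weight *)

Section PartialFunctors.
Variables (R : comPzRingType) (C : linCat R) (P : C -> Prop).

(** [pullS H f x] is f^* x for a contravariant functor H that is defined
    only on the full subcategory P. *)
Definition pullS (H : linFunctor (op (fullsub P)) (modCat R)) (A B : fullsub P)
    (f : lhom (sval A) (sval B)) :
    {linear (H B : lmodType R) -> (H A : lmodType R)} :=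
  @pull R (fullsub P) H A B f.

Variable H : linFunctor (op (fullsub P)) (modCat R).
Implicit Types A B E : fullsub P.

Lemma pullS1 A x : pullS H (lid (sval A)) x = x :> H A.
Proof. exact: (@pull1 R (fullsub P) H A x). Qed.

Lemma pullS_comp A B E (f : lhom (sval A) (sval B)) (g : lhom (sval B) (sval E)) x :
  pullS H f (pullS H g x) = pullS H (g ∘ f) x.
Proof. exact: (esym (@pullM R (fullsub P) H A B E f g x)). Qed.

Lemma pullSP A B k (f g : lhom (sval A) (sval B)) x :
  pullS H (k *: f + g) x = k *: pullS H f x + pullS H g x.
Proof. exact: (@pullP R (fullsub P) H A B k f g x). Qed.

Lemma pullSD A B (f g : lhom (sval A) (sval B)) x :
  pullS H (f + g) x = pullS H f x + pullS H g x.
Proof. by rewrite -[f]scale1r pullSP !scale1r. Qed.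

Lemma pullS0 A B x : pullS H (0 : lhom (sval A) (sval B)) x = 0.
Proof. by apply: (addrI (pullS H 0 x)); rewrite -pullSD !addr0. Qed.

Lemma pullSN A B (f : lhom (sval A) (sval B)) x : pullS H (- f) x = - pullS H f x.
Proof. by rewrite -[- f]addr0 -scaleN1r pullSP pullS0 addr0 scaleN1r. Qed.

Lemma pullSB A B (f g : lhom (sval A) (sval B)) x :
  pullS H (f - g) x = pullS H f x - pullS H g x.
Proof. by rewrite pullSD pullSN. Qed.
End PartialFunctors.

Section Restriction.
Variables (R : comPzRingType) (C : linCat R) (P : C -> Prop).
Variable H : linFunctor (op C) (modCat R).

Lemma pull0 X Y x : pull H (0 : lhom X Y) x = 0.
Proof. by rewrite /pull (linear0 (@lfmap R (op C) (modCat R) H Y X)). Qed.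

(** The restriction of H to the full subcategory P. *)
Definition restr : linFunctor (op (fullsub P)) (modCat R) :=
  @LinFunctor R (op (fullsub P)) (modCat R)
    (fun X => H (sval X))
    (fun X Y => @lfmap R (op C) (modCat R) H (sval X) (sval Y))
    (fun X => lfmap1 H (sval X))
    (fun X Y Z f g => @lfmapM R (op C) (modCat R) H (sval X) (sval Y) (sval Z) f g).
End Restriction.

(** Exactness of H at Y for the triangles X -> Y -> Z of C with all three
    vertices in P. *)
Definition exact_on (R : comPzRingType) (C : triCat R) (P : C -> Prop)
    (H : linFunctor (op (fullsub P)) (modCat R)) : Prop :=
  forall (X Y Z : fullsub P) (f : lhom (sval X) (sval Y))
    (g : lhom (sval Y) (sval Z)) (h : lhom (sval Z) (sh C (sval X))),
  dist f g h -> forall y, pullS H f y = 0 -> exists z, pullS H g z = y.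

Section KanExtension.
Variables (R : comPzRingType) (C : triCat R) (w : weightStr C) (D : wDecs w).
Variable n : int.
Variable H : linFunctor (op (fullsub (wle w n))) (modCat R).
Implicit Types (X Y Z M N : C) (A B : fullsub (wle w n)).

(** w_{<=n} M as an object of the subcategory of objects of weight <= n. *)
Definition leObj M : fullsub (wle w n) := exist _ _ (wd_leP (D n M)).

(** Let i : w_{<=n} M -> M. A compatible family of elements of H(A), indexed
    by the morphisms a : A -> M with A of weight <= n, is determined by its
    member x at i. The elements x that arise in this way are those with
    b^* x = 0 whenever i b = 0. *)
Definition coherent M (x : (H (leObj M) : lmodType R)) : Prop :=
  forall A (b : lhom (sval A) (wd_le (D n M))),
    wd_i (D n M) ∘ b = 0 -> pullS H (B := leObj M) b x = 0.

Lemma coherent_eq M x A (b b' : lhom (sval A) (wd_le (D n M))) :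
  coherent x -> wd_i (D n M) ∘ b = wd_i (D n M) ∘ b' ->
  pullS H (B := leObj M) b x = pullS H (B := leObj M) b' x.
Proof.
move=> xc bb'; apply/eqP; rewrite -subr_eq0 -pullSB; apply/eqP/xc.
exact/lcomp_sub0.
Qed.

(** The morphisms j exhibit T(M) as the module of coherent elements, that is, T
    as the right Kan extension of H. For the exactness of T at Y, the triangle
    X -> Y -> Z is approximated by a triangle w_{<=n} X -> K -> w_{<=n} Z of
    objects of weight <= n, to which the exactness of H applies. *)
Theorem kan_cohomological (T : linFunctor (op C) (modCat R))
    (j : forall M, {linear (T M : lmodType R) -> (H (leObj M) : lmodType R)}) :
  (forall M, injective (j M)) ->
  (forall M x, coherent x <-> exists u, j M u = x) ->
  (forall M N (f : lhom M N) u, exists f0 : lhom (wd_le (D n M)) (wd_le (D n N)),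
     wd_i (D n N) ∘ f0 = f ∘ wd_i (D n M) /\
     j M (pull T f u) = pullS H (A := leObj M) (B := leObj N) f0 (j N u)) ->
  exact_on H -> cohomological T.
Proof.
move=> j_inj j_coh j_nat H_exact X Y Z f g h d y; split; last first.
  by case=> z <-; rewrite -pullM (dist_comp0 d) pull0.
pose i M := wd_i (D n M).
move=> fy; have [f0 [f0E /esym]] := j_nat X Y f y; rewrite fy linear0 => f0y.
have cy : coherent (j Y y) by apply/j_coh; exists y.
have [l lE] : exists l, lfmap (sh C) (i X) ∘ l = h ∘ i Z.
  have dX := proj1 (dist_sh _ _ _) (wd_dist (D n X)).
  apply: (dist_liftL dX); apply: (wle_wge0 _ (wd_leP (D n Z)) _ _); last first.
    exact: shifted_sh (wd_geP (D n X)).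
  by rewrite -addrA ltrDl.
(* The target of l is w_{<=n+1} of X[1]. The extra degree makes a morphism to
   it from an object of weight <= n depend only on its composite to X[1]. *)
have sh_i_inj A (u : lhom (sval A) (sh C (wd_le (D n X)))) :
    lfmap (sh C) (i X) ∘ u = 0 -> u = 0.
  move=> /(dist_liftL_sh (wd_dist (D n X)))[v <-].
  by rewrite (hom_wle_wge (svalP A) (wd_geP (D n X)) v) lcompm0.
have [K0 [f' [g' d']]] := dist_cocone l.
have [k [kf kg]] := dist_mor_mid d' d lE.
have Kn : wle w n K0 := wle_ext d' (wd_leP _) (wd_leP _).
pose K : fullsub (wle w n) := exist _ K0 Kn.
have [k' k'E] := wd_i_lift (D n Y) k Kn.
pose yK := pullS H (A := K) (B := leObj Y) k' (j Y y).
(* The member at a of the family given by y vanishes if a comes from X. *)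
have kill A (a : lhom (sval A) (wd_le (D n Y))) (r : lhom (sval A) X) :
    i Y ∘ a = f ∘ r -> pullS H (B := leObj Y) a (j Y y) = 0.
  move=> ar; have [r' r'E] := wd_i_lift (D n X) r (svalP A).
  rewrite (@coherent_eq _ _ _ a (f0 ∘ r') cy); last by rewrite -/(i Y) ar lcompA f0E -lcompA r'E.
  by rewrite -(pullS_comp _ (B := leObj X)) f0y linear0.
have [z zE] : exists z, pullS H (A := K) (B := leObj Z) g' z = yK.
  apply: (H_exact (leObj X) K (leObj Z) _ _ _ d').
  by rewrite pullS_comp; apply: (kill (leObj X) _ (i X)); rewrite lcompA k'E.
have [z' z'E] : exists z', j Z z' = z.
  apply/j_coh => A b ib.
  have lb : l ∘ b = 0 by apply: (@sh_i_inj A); rewrite lcompA lE -lcompA ib lcompm0.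
  have [b' b'E] := dist_liftL_rot d' lb.
  rewrite -b'E -(pullS_comp _ (B := K)) zE pullS_comp.
  have [r rE] : exists r, f ∘ r = k ∘ b'.
    by apply: (dist_liftL d); rewrite lcompA -kg -lcompA b'E ib.
  by apply: (kill _ _ r); rewrite lcompA k'E.
exists z'; apply: j_inj; have [g0 [g0E ->]] := j_nat Y Z g z'.
rewrite z'E.
have lg0 : l ∘ g0 = 0.
  apply: (@sh_i_inj (leObj Y)); rewrite lcompA lE -lcompA g0E lcompA (dist_comp0_rot d).
  by rewrite lcomp0m.
have [c cE] := dist_liftL_rot d' lg0.
rewrite -cE -(pullS_comp _ (A := leObj Y) (B := K)) zE pullS_comp.
have [r rE] : exists r, f ∘ r = k ∘ c - i Y.
  by apply: (dist_liftL d); apply/lcomp_sub0; rewrite lcompA -kg -lcompA cE g0E.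
apply/eqP; rewrite -subr_eq0 -[X in _ - X](pullS1 (A := leObj Y)) -pullSB; apply/eqP.
by apply: (kill (leObj Y) _ r); rewrite lcompmB lcompA k'E lcompm1.
Qed.

Definition kan_pred M : (H (leObj M) : lmodType R) -> bool := fun x => `[< coherent x >].

Fact kan_pred_closed M : GRing.submod_closed (@kan_pred M).
Proof.
split; first by apply/asboolP => A b _; rewrite linear0.
move=> a x y /asboolP xc /asboolP yc; apply/asboolP => A b ib.
by rewrite linearP xc// yc// scaler0 addr0.
Qed.
HB.instance Definition _ M :=
  GRing.isSubmodClosed.Build R (H (leObj M)) (@kan_pred M) (@kan_pred_closed M).

(** The module of coherent elements. *)
Record kanMod M := KanMod { kan_val : (H (leObj M) : lmodType R); _ : kan_val \in @kan_pred M }.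
HB.instance Definition _ M := [isSub for @kan_val M].
HB.instance Definition _ M := [Choice of kanMod M by <:].
HB.instance Definition _ M := [SubChoice_isSubLmodule of kanMod M by <:].

Definition kan_incl M : {linear kanMod M -> (H (leObj M) : lmodType R)} :=
  (val : kanMod M -> (H (leObj M) : lmodType R)).

Lemma kan_incl_inj M : injective (@kan_incl M).
Proof. exact: val_inj. Qed.

Lemma kan_inclP M (u : kanMod M) : coherent (kan_incl _ u).
Proof. by case: u => x xP; have /asboolP := xP. Qed.

Fact kan_map_subproof M N (f : lhom M N) (u : kanMod N) :
  pullS H (A := leObj M) (B := leObj N) (wle_map D n f) (kan_incl _ u) \in @kan_pred M.
Proof.
apply/asboolP => A b ib; rewrite pullS_comp; apply: (kan_inclP u).
by rewrite lcompA wle_mapE -lcompA ib lcompm0.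
Qed.

Definition kan_map_fun M N (f : lhom M N) (u : kanMod N) : kanMod M :=
  KanMod (kan_map_subproof f u).

Fact kan_map_fun_linear M N (f : lhom M N) : linear (kan_map_fun f).
Proof. by move=> a u v; apply: kan_incl_inj; rewrite /= !linearP. Qed.
HB.instance Definition _ M N (f : lhom M N) := GRing.isLinear.Build R
  (kanMod N) (kanMod M) *:%R (kan_map_fun f) (kan_map_fun_linear f).

Definition kan_obj (M : op C) : modCat R := kanMod M.
Definition kan_map (M N : op C) (f : lhom M N) : lhom (kan_obj M) (kan_obj N) :=
  (@kan_map_fun N M f : {linear kanMod M -> kanMod N}).

Fact kan_map_linear (M N : op C) : linear (@kan_map M N).
Proof.
move=> k f g; apply: linear_ext => u; apply: kan_incl_inj => /=.
rewrite -(@pullSP _ _ _ H (leObj N) (leObj M)).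
apply: (coherent_eq (A := leObj N) (kan_inclP u)).
by rewrite lcompmD lcompmZ !wle_mapE lcompDm lcompZm.
Qed.
HB.instance Definition _ (M N : op C) := GRing.isLinear.Build R
  (lhom M N) (lhom (kan_obj M) (kan_obj N)) *:%R (@kan_map M N) (@kan_map_linear M N).

Fact kan_map1 (M : op C) : kan_map (lid M) = lid (kan_obj M).
Proof.
apply: linear_ext => u; apply: kan_incl_inj => /=.
rewrite -[RHS](pullS1 (A := leObj M)).
apply: (coherent_eq (A := leObj M) (kan_inclP u)).
by rewrite wle_mapE lcomp1m lcompm1.
Qed.

Fact kan_mapM (M N L : op C) (f : lhom M N) (g : lhom N L) :
  kan_map (g ∘ f) = kan_map g ∘ kan_map f.
Proof.
apply: linear_ext => u; apply: kan_incl_inj => /=.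
rewrite (@pullS_comp _ _ _ H (leObj L) (leObj N) (leObj M)).
apply: (coherent_eq (A := leObj L) (kan_inclP u)).
by rewrite wle_mapE lcompA wle_mapE -!lcompA wle_mapE.
Qed.

(** The right Kan extension of H to C. *)
Definition kan : linFunctor (op C) (modCat R) :=
  @LinFunctor R (op C) (modCat R) kan_obj (fun M N => @kan_map M N) kan_map1 kan_mapM.

Lemma kan_pull M N (f : lhom M N) (u : kanMod N) :
  kan_incl _ (pull kan f u : kanMod M) =
  pullS H (A := leObj M) (B := leObj N) (wle_map D n f) (kan_incl _ u).
Proof. by []. Qed.

Corollary kan_exact : exact_on H -> cohomological kan.
Proof.
apply: (@kan_cohomological kan kan_incl) => [|M x|M N f u]; first exact: kan_incl_inj.
  split=> [xc|[u <-]]; last exact: kan_inclP.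
  have xP : x \in @kan_pred M by apply/asboolP.
  by exists (KanMod xP).
by exists (wle_map D n f); split; [apply: wle_mapE|].
Qed.
End KanExtension.

(** * Virtual truncations *)

Section VirtualTruncationsOfFiniteType.
Variables (R : comPzRingType) (C : triCat R) (w : weightStr C) (D : wDecs w).
Variables (H : linFunctor (op C) (modCat R)).
Hypothesis H_coh : cohomological H.
Implicit Types (X Y Z M N : C) (m n : int).

Lemma cohomological_exact X Y Z (f : lhom X Y) (g : lhom Y Z) (h : lhom Z (sh C X)) y :
  dist f g h -> pull H f y = 0 -> exists z, pull H g z = y.
Proof. by move=> d /(H_coh d). Qed.

(** The image of H(w_{<=n+1} M) consists of the coherent elements, because the
    fibre of w_{<=n} M -> w_{<=n+1} M has weight <= n and is zero on M. *)
Lemma tau_ge_coherent n M x :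
  coherent (D := D) (H := restr (wle w n) H) (M := M) x <->
  exists u, pull H (wle_conn D (ltD1 n) M) u = x.
Proof.
set c := wle_conn _ _ _; split=> [xc|[u <-] A b ib]; last first.
  change (pull H b (pull H c u) = 0); rewrite -pullM.
  suff -> : c ∘ b = 0 by apply: pull0.
  apply: (@wd_i_inj _ _ _ _ _ (D (n + 1) M)); first by rewrite addrK; apply: (svalP A).
  by rewrite lcompA wle_connE.
have [F [f [h d]]] := dist_fiber c.
apply: (cohomological_exact d).
have Fn : wle w n F.
  apply: wle_of_sh; apply: wle_ext (dist_inv_rot d) (wd_leP _) _.
  exact: shifted_sh (wd_leP _).
apply: (xc (exist _ F Fn) f) => /=.
by rewrite -(wle_connE D (ltD1 n)) -lcompA (dist_comp0 d) lcompm0.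
Qed.

Lemma tau_ge_cohomological n : cohomological (tau_geN D H n).
Proof.
apply: (@kan_cohomological _ _ _ D n (restr _ H) (tau_geN D H n)
  (fun M => im_incl (pull H (wle_conn D (ltD1 n) M)))).
- by move=> M; apply: im_incl_inj.
- move=> M x; apply: iff_trans (tau_ge_coherent _) _.
  split=> [[u <-]|[y <-]]; first exact: im_incl_ex.
  by have [u ->] := im_inclP y; exists u.
- move=> M N f u; exists (wle_map D n f); split; first exact: wle_mapE.
  by [].
- by move=> X Y Z f g h d y fy; apply: (cohomological_exact d fy).
Qed.

(** An element of tau^{<= -n}(H)(Y) comes from some y in H(w_{>=n} Y). If it
    dies at X, then the restriction of y to w_{>=n} X is e^* q, where
    e : w_{>=n} X -> Q is the cone of w_{>=n-1} X -> w_{>=n} X. Hence (y, - q)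
    comes from the cone K of w_{>=n} X -> w_{>=n} Y (+) Q, which has weight
    >= n, and a morphism of triangles gives Z -> K. *)
Lemma tau_le_cohomological n : cohomological (tau_leN D H n).
Proof.
move=> X Y Z f g h d u; split; last first.
  by case=> v <-; rewrite -pullM (dist_comp0 d) pull0.
pose c M := wge_conn D (ltB2B1 n) M.
pose p M := wd_p (D (n - 1) M).
have geP M : wge w n (wd_ge (D (n - 1) M)).
  by rewrite -[X in wge w X](subrK 1); apply: wd_geP.
have cP M : c M ∘ wd_p (D (n - 2) M) = p M by apply: wge_connE.
have [y uE] := im_inclP u.
pose f1 := wge_map D (n - 1) f; pose g0 := wge_map D (n - 2) g.
move=> /(congr1 (im_incl _)); rewrite linear0.
rewrite [LHS](_ : _ = pull H (wge_map D (n - 2) f) (im_incl _ u)) //.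
rewrite uE -pullM (wge_comm D (ltB2B1 n)) pullM -/(c X) -/f1 => fy.
have [Q [e [q dQ]]] := dist_cone (c X).
have Qn : wge w n Q.
  apply: wge_ext (proj1 (dist_rot _ _ _) dQ) (geP X) _.
  have := shifted_sh (wd_geP (D (n - 2) X)).
  by rewrite (_ : n - 2 + 1 + 1 = n) // -!addrA addr0.
have [yQ yQE] := cohomological_exact dQ fy.
have ep : e ∘ p X = 0 by rewrite -cP lcompA (dist_comp0 dQ) lcomp0m.
have [B Bbi] := biproduct_exists (wd_ge (D (n - 1) Y)) Q.
have Bn := wge_biproduct Bbi (geP Y) Qn.
case: Bbi => i1 [i2 [p1 [p2 [e11 e22 eB]]]].
have [e21 e12] := biproduct_cross e11 e22 eB.
pose b := i1 ∘ f1 + i2 ∘ e.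
pose x := pull H p1 y - pull H p2 yQ.
have bx : pull H b x = 0.
  rewrite linearB -!pullM !lcompmD !lcompA e11 e12 e21 e22 !lcomp1m !lcomp0m add0r addr0.
  by rewrite -yQE subrr.
have [K [k [k' dK]]] := dist_cone b.
have Kn : wge w n K.
  apply: wge_ext (proj1 (dist_rot _ _ _) dK) Bn _.
  by apply: wge_mono (shifted_sh (geP X)); rewrite lerDl.
have [t tE] := cohomological_exact dK bx.
have [|z [zg _]] := dist_mor (a := p X) (b := i1 ∘ p Y) d dK.
  rewrite lcompDm -!lcompA ep lcompm0 addr0; congr (_ ∘ _); apply/esym.
  exact: wge_mapE.
have [|z' z'E] := wd_p_lift (D (n - 1) Z) z; first by rewrite subrK.
have [v vE] := im_incl_ex (pull H (c Z)) (pull H z' t).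
exists v; apply: im_incl_inj; rewrite uE.
rewrite [LHS](_ : _ = pull H g0 (im_incl _ v)) // vE -!pullM.
have -> : z' ∘ (c Z ∘ g0) = k ∘ i1 ∘ c Y.
  apply/eqP; rewrite -subr_eq0; apply/eqP.
  apply: (@wd_p_inj _ _ _ _ _ (D (n - 2) Y)); first by rewrite subrK.
  rewrite lcompBm -[_ ∘ c Y ∘ _]lcompA cP -!lcompA wge_mapE !lcompA.
  by rewrite -[z' ∘ _ ∘ _]lcompA cP z'E zg !lcompA subrr.
have xi : pull H i1 x = y by rewrite linearB -!pullM e11 e21 pull1 pull0 subr0.
by rewrite !pullM tE xi.
Qed.

Hypothesis w_bdd : w_bounded w.
Hypothesis H_fin : finite_type H.

(** It suffices to compare T with H on the objects of large and of small
    weights. *)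
Lemma finite_support_transfer (T : linFunctor (op C) (modCat R)) a b :
  (forall X, wge w a X -> (forall x : H X, x = 0) -> forall x : T X, x = 0) ->
  (forall X, wle w b X -> (forall x : H X, x = 0) -> forall x : T X, x = 0) ->
  forall M, exists s : seq int, forall i, i \notin s ->
    forall x : (T (shift i M) : lmodType R), x = 0.
Proof.
move=> Ta Tb M; have [s sP] := bounded_almost_all w_bdd Ta Tb M.
have [_ _ /(_ M)[s' s'P]] := H_fin.
exists (s ++ s') => i; rewrite mem_cat negb_or => /andP[i1 i2].
exact: sP i i1 (s'P i i2).
Qed.

Lemma tau_ge_finite_type n : finite_type (tau_geN D H n).
Proof.
split; first exact: tau_ge_cohomological.
  by move=> M; apply: fin_gen_im; case: H_fin => _ H_fg _; apply: H_fg.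
pose c M := wle_conn D (ltD1 n) M.
apply: (@finite_support_transfer _ (n + 1) n) => X Xn H0 x; apply: im_incl_inj.
  have [u ->] := im_inclP x; rewrite linear0 [X in pull H X](_ : _ = 0) ?pull0//.
  apply: (@wd_i_inj _ _ _ _ _ (D (n + 1) X)); first by rewrite addrK; apply: wd_leP.
  by rewrite wle_connE; apply: hom_wle_wge (wd_leP _) Xn _.
have [s sE] := wd_i_split (D (n + 1) X) (wleS Xn).
have cE : c X = s ∘ wd_i (D n X).
  apply/eqP; rewrite -subr_eq0; apply/eqP; apply: (@wd_i_inj _ _ _ _ _ (D (n + 1) X)).
    by rewrite addrK; apply: wd_leP.
  by rewrite lcompmB wle_connE lcompA sE lcomp1m subrr.
have [u ->] := im_inclP x.
by rewrite linear0 [X in pull H X]cE pullM (H0 (pull H s u)) linear0.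
Qed.

(** The connecting morphism factors through X if X has weight >= n - 1, and
    vanishes if X has weight <= n - 1. *)
Lemma wge_conn_split n X : wge w (n - 1) X ->
  exists r : lhom (wd_ge (D (n - 2) X)) X,
    wge_conn D (ltB2B1 n) X = wge_conn D (ltB2B1 n) X ∘ wd_p (D (n - 2) X) ∘ r.
Proof.
move=> Xn; have [|r rE] := @wd_p_split _ _ _ _ _ (D (n - 2) X).
  by rewrite -addrA.
exists r; apply/eqP; rewrite -subr_eq0; apply/eqP.
apply: (@wd_p_inj _ _ _ _ _ (D (n - 2) X)).
  by rewrite subrK -[X in wge w X](subrK 1); apply: wd_geP.
by rewrite lcompBm -(lcompA _ r) rE lcompm1 subrr.
Qed.

Lemma wge_conn_eq0 n X : wle w (n - 1) X -> wge_conn D (ltB2B1 n) X = 0.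
Proof.
move=> Xn; apply: (@wd_p_inj _ _ _ _ _ (D (n - 2) X)).
  by rewrite subrK -[X in wge w X](subrK 1); apply: wd_geP.
by rewrite wge_connE; apply: hom_wle_wge Xn (wd_geP _) _.
Qed.

Lemma tau_le_finite_type n : finite_type (tau_leN D H n).
Proof.
split; first exact: tau_le_cohomological.
  by move=> M; apply: fin_gen_im; case: H_fin => _ H_fg _; apply: H_fg.
apply: (@finite_support_transfer _ (n - 1) (n - 1)) => X Xn H0 x; apply: im_incl_inj.
  have [u ->] := im_inclP x; have [r rE] := wge_conn_split Xn.
  by rewrite linear0 [X in pull H X]rE pullM (H0 (pull H _ u)) linear0.
by have [u ->] := im_inclP x; rewrite linear0 [X in pull H X](wge_conn_eq0 Xn) pull0.
Qed.
End VirtualTruncationsOfFiniteType.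

(** * The adjacent t-structure *)

Section NaturalTransformations.
Variables (R : comPzRingType) (C : linCat R).

Lemma nt_pull (F G : linFunctor (op C) (modCat R)) (a : natTrans F G) (X Y : C)
    (f : lhom X Y) u : a X (pull F f u) = pull G f (a Y u).
Proof.
exact: (congr1 (fun t : {linear (F Y : lmodType R) -> (G X : lmodType R)} => t u)
  (@nt_natural _ _ _ _ _ a Y X f)).
Qed.

Lemma nt_cancel (F G : linFunctor (op C) (modCat R)) (a : natTrans F G) (b : natTrans G F) :
  nt_comp b a = nt_id F -> forall X u, b X (a X u) = u.
Proof.
move=> ba X u.
exact: (congr1 (fun t : natTrans F F => (t X : {linear (F X : lmodType R) -> _}) u) ba).
Qed.

Lemma pull_yoneda (N X Y : C) (f : lhom X Y) (x : lhom Y N) : pull (yoneda N) f x = x ∘ f.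
Proof. by []. Qed.
End NaturalTransformations.

Section Adjacent.
Variables (R : comPzRingType) (C : triCat R) (w : weightStr C).
Hypotheses (w_bdd : w_bounded w) (sat : saturated C).
Implicit Types (X Y Z M N L : C).

Lemma yoneda_finite_type M : finite_type (yoneda (M : tcat C)).
Proof. by apply/sat; exists M, (nt_id _), (nt_id _); rewrite /= nt_comp1m. Qed.

Lemma tau_yoneda_representable (D : wDecs w) i M :
  representable (tau_leN D (yoneda (M : tcat C)) i) /\
  representable (tau_geN D (yoneda (M : tcat C)) i).
Proof.
have fM := yoneda_finite_type M; have [cM _ _] := fM.
by split; apply/sat; [apply: tau_le_finite_type|apply: tau_ge_finite_type].
Qed.

(** L represents tau^{<= 0} H_M, and l corresponds to the natural map from
    tau^{<= 0} H_M to H_M, which is bijective on objects of weight >= 0 and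
    injective on objects of weight >= -1. *)
Lemma wge0_approximation M : exists L (l : lhom L M),
  [/\ wge0 w L, forall X (f : lhom X M), wge w 0 X -> exists f', l ∘ f' = f
    & forall X (f : lhom X L), wge w (-1) X -> l ∘ f = 0 -> f = 0].
Proof.
have [D] := wDecs_exists w.
have [[L [a [b [/= ba ab]]]] _] := tau_yoneda_representable D 0 M.
pose G := tau_leN D (yoneda (M : tcat C)) 0.
pose conn X := wge_conn D (ltB2B1 0) X.
pose val_ X (u : G X) := im_incl (pull (yoneda (M : tcat C)) (conn X)) u.
pose eps X (u : G X) : lhom X M := val_ X u ∘ wd_p (D (0 - 2) X).
have valE X (u : G X) : exists v : lhom _ M, val_ X u = v ∘ conn X.
  by have [v vE] := im_inclP u; exists v.
have eps_nat X Y (f : lhom X Y) (u : G Y) : eps X (pull G f u) = eps Y u ∘ f.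
  rewrite /eps (_ : val_ X _ = val_ Y u ∘ wge_map D (0 - 2) f) //.
  by rewrite -!lcompA wge_mapE.
pose l := eps L (b L (lid L)).
have lE X (f : lhom X L) : eps X (b X f) = l ∘ f.
  by rewrite -eps_nat -(nt_pull b) pull_yoneda lcomp1m.
exists L, l; split.
- apply/wge0E/wge_orth => X Xn f.
  rewrite -[f](nt_cancel ab) (_ : b X f = 0) ?linear0//.
  apply: im_incl_inj; rewrite linear0.
  have [v vE] := valE X (b X f); apply: (etrans vE).
  by rewrite /conn (wge_conn_eq0 D Xn) lcompm0.
- move=> X f X0; have [r rE] : exists r, r ∘ wd_p (D (0 - 1) X) = lid X.
    by apply: wd_p_split; rewrite subrK.
  have [u uE] := im_incl_ex (pull (yoneda (M : tcat C)) (conn X)) (f ∘ r).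
  exists (a X u); rewrite -lE (nt_cancel ba) /eps /val_ uE pull_yoneda -!lcompA.
  by rewrite wge_connE rE lcompm1.
- move=> X f X1; rewrite -lE => e0; rewrite -[f](nt_cancel ab) (_ : b X f = 0) ?linear0//.
  have [|r rE] := @wge_conn_split _ _ _ D 0 X; first by rewrite sub0r.
  apply: im_incl_inj; rewrite linear0.
  have [v vE] := valE X (b X f); apply: (etrans vE).
  rewrite /conn rE !lcompA -/(conn X) -vE.
  by rewrite [_ ∘ wd_p _]e0 lcomp0m.
Qed.

(** The right orthogonal of the objects of weight >= 1. *)
Definition right_orth Y : Prop := forall X, wge w 1 X -> forall f : lhom X Y, f = 0.

Lemma right_orth_iso X Y : right_orth X -> @isomorphic C X Y -> right_orth Y.
Proof.
move=> X0 [f [g /= [_ fg]]] Z Z1 h.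
by rewrite -[h]lcomp1m -fg -lcompA (X0 Z Z1 (g ∘ h)) lcompm0.
Qed.

Lemma wge0_iso X Y : wge0 w X -> @isomorphic C X Y -> wge0 w Y.
Proof. by move=> X0 /iso_retract; apply: wge0_retract. Qed.

Lemma right_orth_shift X : right_orth X -> shifted right_orth 1 X.
Proof.
move=> X0; exists (shV C X); last exact: iso_sym (iso_sh_shV X).
move=> Y Y1 f; apply: sh_faithful; rewrite linear0.
have [e [e' /= [e'e _]]] := iso_sh_shV X.
rewrite -[LHS]lcomp1m -e'e -lcompA [e ∘ _](X0 (sh C Y)) ?lcompm0//.
exact: wgeS (shifted_sh Y1).
Qed.

(** The cone N of the approximation L -> M by an object of weight >= 0 is right
    orthogonal to the objects of weight >= 0. *)
Lemma adjacent_dec M : exists L N (f : lhom L M) (g : lhom M N) (h : lhom N (sh C L)),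
  [/\ dist f g h, wge0 w L & shifted right_orth (-1) N].
Proof.
have [L [l [L0 l_surj l_inj]]] := wge0_approximation M.
have [N [g [h d]]] := dist_cone l.
exists L, N, l, g, h; split => //; exists (sh C N); last exact: iso_sym (iso_shV_sh N).
have N0 X (u : lhom X N) : wge w 0 X -> u = 0.
  move=> X0.
  have hu : h ∘ u = 0.
    have [e [e' [v [ee' vE]]]] := hom_into_sh (h ∘ u).
    rewrite -[LHS]lcompm1 -ee' lcompA vE (l_inj _ v) ?linear0 ?lcomp0m//.
      by apply: shifted_shV; rewrite addNr.
    by apply: sh_faithful; rewrite lfmapM -vE linear0 !lcompA (dist_comp0_shift d) !lcomp0m.
  have [v <-] := dist_liftL_rot d hu; have [v' <-] := l_surj _ v X0.
  by rewrite lcompA (dist_comp0 d) lcomp0m.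
move=> X X1 u; have [e [e' [v [ee' vE]]]] := hom_into_sh u.
rewrite -[LHS]lcompm1 -ee' lcompA vE (N0 _ v) ?linear0 ?lcomp0m//.
by apply: shifted_shV; rewrite add0r.
Qed.

Lemma wge1_right_orth X Y : shifted (wge0 w) 1 X -> right_orth Y -> forall f : lhom X Y, f = 0.
Proof. by move=> X1 Y0 f; apply: Y0 X1 f. Qed.

(** The t-structure with aisle the objects of weight >= 0. *)
Definition adjacent_tStr : tStr C :=
  @TStr R C (wge0 w) right_orth wge0_iso right_orth_iso (@wge0_shift _ _ w)
    right_orth_shift wge1_right_orth adjacent_dec.
End Adjacent.

Section RightAdjacent.
Variables (R : comPzRingType) (C : triCat R) (w : weightStr C) (t : tStr C).
Hypothesis wt : right_adjacent w t.
Implicit Types (X Y Z M N L : C).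

Lemma tge0_right_orth N : tge0 t N -> right_orth w N.
Proof.
by move=> N0 X [Y Y0 XY]; apply: t_orth N0; exists Y => //; apply/wt.
Qed.

(** In the truncation triangle L -> M[-1] -> N of t, the first morphism is zero
    because L[1] has weight >= 1. The orthogonality of L[1] and N then makes L
    zero and N isomorphic to M[-1]. *)
Lemma right_orth_tge0 M : right_orth w M -> tge0 t M.
Proof.
move=> M0; have [L [N [f [g [h [d L0 [Y Y0 NY]]]]]]] := t_dec t (shV C M).
have shL : wge w 1 (sh C L) by exists L; [apply/wt|apply: iso_refl].
have f0 : f = 0.
  apply: sh_faithful; rewrite linear0; have [e [e' /= [e'e _]]] := iso_sh_shV M.
  by rewrite -[LHS]lcomp1m -e'e -lcompA (M0 _ shL (e ∘ _)) lcompm0.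
have h0 : h = 0.
  have [|s sE] := dist_liftL_sh (u := lid (sh C L)) d.
    by rewrite f0 linear0 lcomp0m.
  suff s0 : s = 0 by rewrite -[h]lcomp1m -sE s0 lcompm0 lcomp0m.
  have [c [c' /= [c'c _]]] := iso_trans (iso_fun (sh C) NY) (iso_sh_shV Y).
  apply: sh_faithful; rewrite linear0 -[LHS]lcomp1m -c'c -lcompA.
  rewrite (_ : c ∘ _ = 0) ?lcompm0//; apply: t_orth Y0 _.
  exists (sh C L); last exact: iso_refl.
  apply/wt/wge0_shift; exists L; [exact/wt|exact: iso_refl].
have [|r rg] := dist_liftR (u := lid (shV C M)) d; first by rewrite f0 lcompm0.
have [|s gs] := dist_liftL_rot (u := lid N) d; first by rewrite h0 lcomp0m.
have MN : @isomorphic C (shV C M) N.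
  have rs : r = s by rewrite -[r]lcompm1 -gs lcompA rg lcomp1m.
  by exists g, r; split=> //=; rewrite rs gs.
apply: tge0_iso Y0 _; apply: iso_trans (iso_sym (iso_sh_shV Y)) _.
apply: iso_trans (iso_fun (sh C) (iso_sym NY)) _.
exact: iso_trans (iso_fun (sh C) (iso_sym MN)) (iso_sh_shV M).
Qed.
End RightAdjacent.

(** * Full faithfulness on the heart *)

Section FullyFaithful.
Variables (R : comPzRingType) (C : triCat R) (w : weightStr C).
Implicit Types (X Y Z M N L P : C).

(** The objects of the heart of the weight structure. *)
Definition inHeart X : Prop := wle0 w X /\ wge0 w X.

Lemma inHeartP X : inHeart X <-> wle w 0 X /\ wge w 0 X.
Proof. by rewrite wle0E wge0E. Qed.

Lemma heart_biproduct (X Y : fullsub inHeart) : exists T : fullsub inHeart,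
  exists (i1 : lhom (sval X) (sval T)) (i2 : lhom (sval Y) (sval T))
    (p1 : lhom (sval T) (sval X)) (p2 : lhom (sval T) (sval Y)),
  [/\ p1 ∘ i1 = lid _, p2 ∘ i2 = lid _, p2 ∘ i1 = 0 & p1 ∘ i2 = 0].
Proof.
have [T bT] := biproduct_exists (sval X) (sval Y).
have /inHeartP[X0 X1] := svalP X; have /inHeartP[Y0 Y1] := svalP Y.
have hT : inHeart T.
  by apply/inHeartP; split; [apply: wle_biproduct bT _ _|apply: wge_biproduct bT _ _].
exists (exist _ T hT); case: bT => i1 [i2 [p1 [p2 [e1 e2 e]]]].
by exists i1, i2, p1, p2; have [] := biproduct_cross e1 e2 e.
Qed.

(** Projective presentation: for N of weight >= 0 there is a complex
    B -> A -> N with A and B in the heart of w, which is right exact for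
    C(P, -) with P in that heart, and left exact for C(-, N') with N'
    orthogonal to the objects of weight >= 1. *)
Lemma heart_presentation N : wge0 w N ->
  exists (A B : C) (r : lhom B A) (p : lhom A N),
  [/\ inHeart A, inHeart B, p ∘ r = 0,
      forall P, inHeart P ->
        (forall x : lhom P N, exists y, p ∘ y = x) /\
        (forall y : lhom P A, p ∘ y = 0 -> exists z, r ∘ z = y)
    & forall N', right_orth w N' ->
        (forall u : lhom N N', u ∘ p = 0 -> u = 0) /\
        (forall v : lhom A N', v ∘ r = 0 -> exists u, u ∘ p = v)].
Proof.
move=> /wge0E N0; have [d] := wDec_exists w 0 N.
have A0 : wge w 0 (wd_le d) by apply: wd_le_wge.
have [V [f [h dV]]] := dist_fiber (wd_i d).
have V0 : wge w 0 V.
  apply: wge_orth => X Xn u; apply: sh_faithful; rewrite linear0.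
  have m10 : 0 - 1 < 0 :> int by [].
  have [|s <-] := dist_liftL_sh (u := lfmap (sh C) u) dV.
    by rewrite -lfmapM (wle_wge0 m10 Xn A0 (f ∘ u)) linear0.
  have [|s' <-] := wd_i_lift d s.
    by rewrite -(subrK 1 0); apply: shifted_sh.
  by rewrite lcompA (dist_comp0_rot dV) lcomp0m.
have [e] := wDec_exists w 0 V.
exists (wd_le d), (wd_le e), (f ∘ wd_i e), (wd_i d); split.
- by apply/inHeartP; split=> //; apply: wd_leP.
- by apply/inHeartP; split; [apply: wd_leP|apply: wd_le_wge].
- by rewrite lcompA (dist_comp0 dV) lcomp0m.
- move=> P /inHeartP[P0 _]; split=> [x|y]; first exact: wd_i_lift.
  move=> /(dist_liftL dV)[z <-]; have [z' <-] := wd_i_lift e z P0.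
  by exists z'; rewrite lcompA.
- move=> N' N'0; split=> [u|v].
    move=> /(dist_liftR (wd_dist d))[v <-].
    by rewrite (N'0 _ _ v) ?lcomp0m//; apply: wd_geP.
  rewrite lcompA => /(dist_liftR (wd_dist e))[c cE].
  apply: (dist_liftR dV).
  by rewrite -cE (N'0 _ _ c) ?lcomp0m//; apply: wd_geP.
Qed.

Variables (t : tStr C) (sat : saturated C).
Hypothesis wt : right_adjacent w t.

(** By the presentation B -> A -> N, both a morphism N -> N' and a natural
    transformation from C(-, N) to C(-, N') amount to a morphism A -> N' that
    is zero on B. *)
Lemma heart_embedding_fully_faithful : fully_faithful (heart_embedding w t sat).
Proof.
move=> [N [N0 N1]] [N' [N'0 N'1]].
have [A [B [r [p [hA hB pr onP onN]]]]] := heart_presentation (proj1 (wt N) N0).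
have [onN0 onN1] := onN N' (tge0_right_orth wt N'1).
pose A' : wHeart w := exist _ A hA; pose B' : wHeart w := exist _ B hB.
apply: inj_surj_bijective => [phi psi /= E|tau].
  apply/eqP; rewrite -subr_eq0; apply/eqP/onN0.
  rewrite lcompBm; apply/eqP; rewrite subr_eq0; apply/eqP.
  have EA := congr1 (fun s => @ntc R (op (wHeart w)) _ _ _ s A') E.
  exact: (congr1 (fun s : {linear lhom A N -> lhom A N'} => s p) EA).
pose ev (P : wHeart w) : {linear lhom (sval P) N -> lhom (sval P) N'} := tau P.
have ev_nat (P Q : wHeart w) (f : lhom (sval P) (sval Q)) x : ev P (x ∘ f) = ev Q x ∘ f.
  exact: (congr1 (fun s : {linear lhom (sval Q) N -> lhom (sval P) N'} => s x)
    (@nt_natural _ _ _ _ _ tau Q P f)).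
have [|u uE] := onN1 (ev A' p).
  by rewrite -(ev_nat B' A') pr linear0.
exists u; apply: natTrans_ext => P; apply: linear_ext => x.
change (u ∘ x = ev P x).
have [y <-] := proj1 (onP _ (svalP P)) x.
by rewrite (ev_nat P A') lcompA uE.
Qed.
End FullyFaithful.

(** * Extending a functor from the heart *)

Section LeftExtension.
Variables (R : comPzRingType) (C : triCat R) (w : weightStr C) (D : wDecs w).
Variable Phi : linFunctor (op (fullsub (inHeart w))) (modCat R).
Implicit Types (A B E : fullsub (wle w 0)) (P Q T : fullsub (inHeart w)).

Fact geObj_subproof A : inHeart w (wd_ge (D (-1) (sval A))).
Proof.
apply/inHeartP; split; first by apply: wd_ge_wle; last exact: (svalP A).
exact: (wd_geP (D (-1) (sval A))).
Qed.

(** For A of weight <= 0, w_{>=0} A as an object of the heart. *)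
Definition geObj A : fullsub (inHeart w) := exist _ _ (geObj_subproof A).
Local Notation proj A := (wd_p (D (-1) (sval A))).

(** The elements e^* q of Phi(w_{>=0} A), for e : w_{>=0} A -> Q with Q in the
    heart and e zero on A. *)
Definition null_pred A : (Phi (geObj A) : lmodType R) -> bool := fun x =>
  `[< exists Q (e : lhom (wd_ge (D (-1) (sval A))) (sval Q)) (q : Phi Q),
        e ∘ proj A = 0 /\ pullS Phi (A := geObj A) e q = x >].

Fact null_pred_closed A : GRing.submod_closed (@null_pred A).
Proof.
split.
  apply/asboolP; exists (geObj A), 0, 0.
  by rewrite lcomp0m linear0.
move=> a _ _ /asboolP[Q [e [q [e0 <-]]]] /asboolP[Q' [e' [q' [e'0 <-]]]].
have [T [i1 [i2 [p1 [p2 [e11 e22 e21 e12]]]]]] := heart_biproduct Q Q'.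
apply/asboolP; exists T, (i1 ∘ e + i2 ∘ e').
exists (a *: pullS Phi p1 q + pullS Phi p2 q'); split.
  by rewrite lcompDm -!lcompA e0 e'0 !lcompm0 addr0.
rewrite linearD linearZ /= !(pullS_comp _ (A := geObj A)).
by rewrite !lcompmD !lcompA e11 e22 e21 e12 !lcomp1m !lcomp0m addr0 add0r.
Qed.

(** The left Kan extension of Phi to the objects A of weight <= 0: the colimit
    of Phi(P) over the morphisms A -> P with P in the heart is the quotient of
    Phi(w_{>=0} A) by these elements. *)
Definition lan_mod A := quotMod (@null_pred_closed A).
Definition lan_proj A : {linear (Phi (geObj A) : lmodType R) -> lan_mod A} :=
  quotP (@null_pred_closed A).

Lemma lan_proj_surj A u : exists x, lan_proj A x = u.
Proof. exact: quotP_surj. Qed.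

Lemma lan_proj_eq0 A x : lan_proj A x = 0 <->
  exists Q (e : lhom (wd_ge (D (-1) (sval A))) (sval Q)) (q : Phi Q),
    e ∘ proj A = 0 /\ pullS Phi (A := geObj A) e q = x.
Proof. by split=> [/quotP_eq0/asboolP//|xP]; apply/quotP_eq0/asboolP. Qed.

Lemma lan_proj_eq A P (a a' : lhom (wd_ge (D (-1) (sval A))) (sval P)) x :
  a ∘ proj A = a' ∘ proj A ->
  lan_proj A (pullS Phi (A := geObj A) a x) = lan_proj A (pullS Phi (A := geObj A) a' x).
Proof.
move=> aa'; apply/eqP; rewrite -subr_eq0 -linearB -pullSB; apply/eqP/lan_proj_eq0.
by exists P, (a - a'), x; rewrite lcompBm aa' subrr.
Qed.

Fact lan_map_subproof A B (b : lhom (sval A) (sval B)) x :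
  x \in @null_pred B ->
  pullS Phi (A := geObj A) (B := geObj B) (wge_map D (-1) b) x \in @null_pred A.
Proof.
move=> /asboolP[Q [e [q [e0 <-]]]]; apply/asboolP.
exists Q, (e ∘ wge_map D (-1) b), q; rewrite (pullS_comp _ (A := geObj A)).
by rewrite -lcompA wge_mapE lcompA e0 lcomp0m.
Qed.

Definition lan_obj (A : op (fullsub (wle w 0))) : modCat R := lan_mod A.
Definition lan_map (A B : op (fullsub (wle w 0))) (b : lhom A B) :
    lhom (lan_obj A) (lan_obj B) :=
  (quot_map (@null_pred_closed A) (@null_pred_closed B)
    (@lan_map_subproof B A b) : {linear lan_mod A -> lan_mod B}).

Lemma lan_mapE (A B : op (fullsub (wle w 0))) (b : @lhom R C (sval B) (sval A)) b1 x :
  b1 ∘ proj B = proj A ∘ b ->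
  (lan_map b : {linear lan_mod A -> lan_mod B}) (lan_proj A x) =
  lan_proj B (pullS Phi (A := geObj B) (B := geObj A) b1 x).
Proof.
move=> b1E; apply: etrans (quot_mapE _ _ (@lan_map_subproof B A b) _) _.
apply: (@lan_proj_eq B (geObj A)).
by rewrite b1E wge_mapE.
Qed.

Fact lan_map_linear (A B : op (fullsub (wle w 0))) : linear (@lan_map A B).
Proof.
move=> k f g; apply: linear_ext => u; have [x <-] := lan_proj_surj u.
apply: etrans (@lan_mapE A B _ (k *: wge_map D (-1) f + wge_map D (-1) g) x _) _.
  by rewrite lcompDm lcompZm !wge_mapE lcompmD lcompmZ.
rewrite pullSP linearP; congr (_ *: _ + _).
  by apply/esym/lan_mapE; apply: wge_mapE.
by apply/esym/lan_mapE; apply: wge_mapE.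
Qed.
HB.instance Definition _ (A B : op (fullsub (wle w 0))) := GRing.isLinear.Build R
  (lhom A B) (lhom (lan_obj A) (lan_obj B)) *:%R (@lan_map A B) (@lan_map_linear A B).

Fact lan_map1 (A : op (fullsub (wle w 0))) : lan_map (lid A) = lid (lan_obj A).
Proof.
apply: linear_ext => u; have [x <-] := lan_proj_surj u.
apply: etrans (@lan_mapE A A _ (lid _) x _) _; first by rewrite lcompm1 lcomp1m.
by rewrite (pullS1 (A := geObj A)).
Qed.

Fact lan_mapM (A B E : op (fullsub (wle w 0))) (f : lhom A B) (g : lhom B E) :
  lan_map (g ∘ f) = lan_map g ∘ lan_map f.
Proof.
apply: linear_ext => u; have [x <-] := lan_proj_surj u.
apply: etrans (@lan_mapE A E _ (wge_map D (-1) f ∘ wge_map D (-1) g) x _) _.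
  by rewrite -lcompA wge_mapE lcompA wge_mapE -lcompA.
apply/esym; rewrite /=.
rewrite (@lan_mapE A B _ _ _ (wge_mapE D (-1) f)) (@lan_mapE B E _ _ _ (wge_mapE D (-1) g)).
by rewrite (pullS_comp _ (A := geObj E) (B := geObj B) (E := geObj A)).
Qed.

Definition lan : linFunctor (op (fullsub (wle w 0))) (modCat R) :=
  @LinFunctor R (op (fullsub (wle w 0))) (modCat R) lan_obj (fun A B => @lan_map A B)
    lan_map1 lan_mapM.

Lemma lan_pull A B (b : lhom (sval A) (sval B)) b1 x :
  b1 ∘ proj A = proj B ∘ b ->
  pullS lan b (lan_proj B x : lan_mod B) =
  lan_proj A (pullS Phi (A := geObj A) (B := geObj B) b1 x) :> lan_mod A.
Proof. exact: (@lan_mapE B A b b1 x). Qed.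

(** Let y in Phi(w_{>=0} Y) represent an element that dies at X, so that its
    restriction to w_{>=0} X is e^* q with e : w_{>=0} X -> Q. Then (y, - q) in
    Phi(T), T = w_{>=0} Y (+) Q, is killed by b : w_{>=0} X -> T. There is a
    morphism from Z to the cone of b, and it lifts to Z -> T because Z has
    weight <= 0 and (w_{>=0} X)[1] has weight >= 1. *)
Lemma lan_exact : exact_on lan.
Proof.
move=> X Y Z f g h d u fu.
have [y yE] := lan_proj_surj u; subst u.
pose f1 := wge_map D (-1) f.
have := fu; rewrite (lan_pull _ (wge_mapE D (-1) f)) -/f1.
move=> /lan_proj_eq0[Q [e [q [ep eq]]]].
have [T [i1 [i2 [p1 [p2 [e11 e22 e21 e12]]]]]] := heart_biproduct (geObj Y) Q.
pose b := i1 ∘ f1 + i2 ∘ e.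
pose x := pullS Phi (B := geObj Y) p1 y - pullS Phi p2 q.
have bx : pullS Phi (A := geObj X) b x = 0.
  rewrite linearB !(pullS_comp _ (A := geObj X)) !lcompmD !lcompA e11 e22 e21 e12.
  by rewrite !lcomp1m !lcomp0m addr0 add0r eq subrr.
have xi : pullS Phi (A := geObj Y) i1 x = y.
  rewrite linearB !(pullS_comp _ (A := geObj Y)) e11 e21.
  by rewrite (pullS1 (A := geObj Y)) (pullS0 (geObj Y)) subr0.
have [K [k [k' dK]]] := dist_cone b.
have [|z [zg _]] := dist_mor (a := proj X) (b := i1 ∘ proj Y) d dK.
  rewrite lcompDm -!lcompA ep lcompm0 addr0; congr (_ ∘ _); apply/esym.
  exact: wge_mapE.
have /inHeartP[_ T0] := svalP T; have /inHeartP[_ gX0] := svalP (geObj X).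
have [|c cE] := dist_liftL_rot (u := z) dK.
  by apply: (hom_wle_wge (svalP Z)); apply: shifted_sh.
have [c1 c1E] := wd_p_lift (D (-1) (sval Z)) c T0.
exists (lan_proj Z (pullS Phi (A := geObj Z) c1 x)).
rewrite (lan_pull _ (wge_mapE D (-1) g)) (pullS_comp _ (A := geObj Y) (B := geObj Z)).
have [r rE] : exists r, b ∘ r = c ∘ g - i1 ∘ proj Y.
  by apply: (dist_liftL dK); apply/lcomp_sub0; rewrite lcompA cE zg.
have [r1 r1E] := wd_p_lift (D (-1) (sval Y)) r gX0.
rewrite (@lan_proj_eq _ _ _ (i1 + b ∘ r1)); last first.
  rewrite -lcompA wge_mapE lcompA c1E lcompDm -[b ∘ _ ∘ _]lcompA r1E rE.
  by rewrite addrC subrK.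
rewrite (pullSD _ (A := geObj Y)) xi -(pullS_comp _ (A := geObj Y) (B := geObj X)).
by rewrite bx linear0 addr0.
Qed.

(** The extension of Phi to C, which vanishes on the objects of weight >= 1 and
    on those of weight <= -1: the left Kan extension of Phi to the objects of
    weight <= 0, followed by the right Kan extension to C. *)
Definition heart_ext : linFunctor (op C) (modCat R) := kan D lan.

Lemma heart_ext_cohomological : cohomological heart_ext.
Proof. exact: kan_exact lan_exact. Qed.

Lemma heart_ext_fin_gen : noetherian R -> (forall P, fin_gen (Phi P)) ->
  forall M, fin_gen (heart_ext M).
Proof.
move=> R_noeth Phi_fg M.
apply: (noetherian_submodule R_noeth (@kan_incl_inj _ _ _ D 0 lan M)).
exact: (fin_gen_quotient (@lan_proj_surj (leObj D 0 M))).
Qed.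

Lemma heart_ext_wge1 M : wge w 1 M -> forall u : heart_ext M, u = 0.
Proof.
move=> M1 u; apply: kan_incl_inj; rewrite linear0.
rewrite -[LHS](pullS1 (A := leObj D 0 M)); apply: (kan_inclP u (A := leObj D 0 M)).
by rewrite lcompm1; apply: (@hom_wle_wge _ _ w 0 _ _ (wd_leP _) M1).
Qed.

Lemma heart_ext_wleN1 M : wle w (-1) M -> forall u : heart_ext M, u = 0.
Proof.
move=> M1 u; apply: kan_incl_inj; rewrite linear0.
have M0 : wle w 0 M := wleS M1.
have [s sE] := wd_i_split (D 0 M) M0.
pose M' : fullsub (wle w 0) := exist _ M M0.
rewrite -[LHS](pullS1 (A := leObj D 0 M)).
rewrite (@coherent_eq _ _ _ _ _ _ _ _ (leObj D 0 M) _ (s ∘ wd_i (D 0 M)) (kan_inclP u)).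
  rewrite -(pullS_comp (H := lan) _ (A := leObj D 0 M) (B := M')).
  have [x <-] := lan_proj_surj (pullS lan (A := M') (B := leObj D 0 M) s (kan_incl D lan _ u)).
  rewrite (_ : lan_proj M' x = 0) ?linear0//; apply/lan_proj_eq0.
  exists (geObj M'), (lid _), x; split; last by rewrite (pullS1 (A := geObj M')).
  by rewrite lcomp1m; apply: (@hom_wle_wge _ _ w (-1) _ _ M1 (wd_geP _)).
by rewrite lcompm1 lcompA sE lcomp1m.
Qed.

Lemma heart_ext_finite_type : w_bounded w -> noetherian R ->
  (forall P, fin_gen (Phi P)) -> finite_type heart_ext.
Proof.
move=> w_bdd R_noeth Phi_fg; split; first exact: heart_ext_cohomological.
  exact: heart_ext_fin_gen.
exact: (bounded_almost_all w_bdd heart_ext_wge1 heart_ext_wleN1).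
Qed.

(** The restriction of the extension to the heart is isomorphic to Phi. *)
Section Unit.
Variable P : fullsub (inHeart w).
Let L := leObj D 0 (sval P).

Fact unit_lift_subproof : exists i' : lhom (wd_ge (D (-1) (sval L))) (sval P),
  i' ∘ proj L = wd_i (D 0 (sval P)).
Proof. by apply: wd_p_lift; have /inHeartP[] := svalP P. Qed.

(** The extension of w_{<=0} P -> P to w_{>=0} (w_{<=0} P). *)
Definition unit_lift := sval (cid unit_lift_subproof).
Lemma unit_liftE : unit_lift ∘ proj L = wd_i (D 0 (sval P)).
Proof. exact: svalP (cid unit_lift_subproof). Qed.

Fact heart_unit_subproof x :
  lan_proj L (pullS Phi (A := geObj L) unit_lift x)
    \in @kan_pred _ _ _ D 0 lan (sval P).
Proof.
apply/asboolP => A b ib; have [b1 b1E] : exists b1, b1 ∘ proj A = proj L ∘ b.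
  by exists (wge_map D (-1) b); apply: wge_mapE.
rewrite (@lan_pull A L b b1)// (pullS_comp _ (A := geObj A) (B := geObj L)).
rewrite (@lan_proj_eq _ _ _ 0) ?(pullS0 (geObj A)) ?linear0//.
by rewrite -lcompA b1E lcompA unit_liftE ib lcomp0m.
Qed.

Definition heart_unit_fun (x : Phi P) : (heart_ext (sval P) : lmodType R) :=
  KanMod (heart_unit_subproof x).

Fact heart_unit_linear : linear heart_unit_fun.
Proof. by move=> a x y; apply: kan_incl_inj; rewrite /= !linearP. Qed.
HB.instance Definition _ := GRing.isLinear.Build R
  (Phi P) (heart_ext (sval P)) *:%R heart_unit_fun heart_unit_linear.

(** The natural map Phi(P) -> heart_ext(P). *)
Definition heart_unit :
  {linear (Phi P : lmodType R) -> (heart_ext (sval P) : lmodType R)} := heart_unit_fun.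

Lemma heart_unitE x : kan_incl D lan _ (heart_unit x) =
  lan_proj L (pullS Phi (A := geObj L) unit_lift x).
Proof. by []. Qed.

Let P_split : exists s, wd_i (D 0 (sval P)) ∘ s = lid (sval P).
Proof. by apply: wd_i_split; have /inHeartP[] := svalP P. Qed.

Lemma heart_unit_inj : injective heart_unit.
Proof.
move=> x x' /eqP; rewrite -subr_eq0 -linearB => /eqP xx'.
apply/eqP; rewrite -subr_eq0; apply/eqP; move: (x - x') xx' => {}x.
move=> /(congr1 (kan_incl D lan _)); rewrite heart_unitE linear0.
move=> /lan_proj_eq0[Q [e [q [ep eq]]]].
have [s sE] := P_split.
rewrite -[x](pullS1 (A := P)) -sE -unit_liftE -lcompA.
rewrite -(pullS_comp _ (A := P) (B := geObj L)) -eq (pullS_comp _ (B := geObj L)).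
by rewrite lcompA ep lcomp0m pullS0.
Qed.

Lemma heart_unit_surj u : exists x, heart_unit x = u.
Proof.
have [y yE] := lan_proj_surj (kan_incl D lan _ u); have [s sE] := P_split.
exists (pullS Phi (A := P) (B := geObj L) (proj L ∘ s) y); apply: kan_incl_inj.
rewrite heart_unitE (pullS_comp _ (A := geObj L) (B := P)).
have := coherent_eq (A := L) (b := s ∘ wd_i (D 0 (sval P))) (b' := lid _) (kan_inclP u).
rewrite lcompA sE lcomp1m lcompm1 => /(_ erefl).
rewrite (pullS1 (A := L)) => <-; rewrite -yE; apply/esym/lan_pull.
by rewrite -!lcompA unit_liftE.
Qed.
End Unit.

Lemma heart_unit_natural P Q (f : lhom (sval P) (sval Q)) x :
  heart_unit P (pullS Phi f x) = pull heart_ext f (heart_unit Q x).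
Proof.
apply: kan_incl_inj; rewrite kan_pull !heart_unitE.
set L := leObj D 0 (sval P); set L' := leObj D 0 (sval Q).
rewrite (@lan_pull L L' _ _ _ (wge_mapE D (-1) (wle_map D 0 f))).
rewrite (pullS_comp _ (A := geObj L) (B := P)) (pullS_comp _ (A := geObj L) (B := geObj L')).
apply: lan_proj_eq; rewrite -!lcompA wge_mapE unit_liftE lcompA unit_liftE.
by rewrite wle_mapE.
Qed.
End LeftExtension.

(** * Essential surjectivity *)

Section EssentialSurjectivity.
Variable R : comPzRingType.

(** A functor into finitely generated modules, with values in all modules. *)
Definition fg_forget (E : linCat R) (F : linFunctor E (fgMod R)) : linFunctor E (modCat R) :=
  @LinFunctor R E (modCat R) (fun X => sval (F X)) (fun X Y => @lfmap R E (fgMod R) F X Y)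
    (fun X => lfmap1 F X) (fun X Y Z f g => @lfmapM R E (fgMod R) F X Y Z f g).

(** A natural transformation with bijective components is invertible. *)
Lemma nt_iso (E : linCat R) (F G : linFunctor E (fgMod R)) (a : natTrans F G) :
  (forall X, injective (a X : {linear sval (F X) -> sval (G X)})) ->
  (forall X y, exists x, (a X : {linear sval (F X) -> sval (G X)}) x = y) ->
  @isomorphic (AddFun E (fgMod R)) G F.
Proof.
move=> a_inj a_surj.
pose b X : {linear sval (G X) -> sval (F X)} :=
  sval (cid (linear_inverse (a_inj X) (a_surj X))).
have [ab ba] : (forall X, cancel (a X : {linear sval (F X) -> sval (G X)}) (b X)) /\
               (forall X, cancel (b X) (a X : {linear sval (F X) -> sval (G X)})).
  by split=> X; have [] := svalP (cid (linear_inverse (a_inj X) (a_surj X))).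
have b_nat X Y (f : lhom X Y) :
    @lcomp R (fgMod R) _ _ _ (b Y) (lfmap G f) = @lcomp R (fgMod R) _ _ _ (lfmap F f) (b X).
  apply: linear_ext => x; apply: (a_inj Y).
  have /= nat_f := congr1 (fun s : {linear sval (F X) -> sval (G Y)} => s (b X x)) (nt_natural a f).
  by apply: etrans (ba Y _) _; apply/esym; apply: etrans nat_f _; rewrite /= ba.
exists (NatTrans b_nat), a; split; apply: natTrans_ext => X; apply: linear_ext => x.
  exact: ba.
exact: ab.
Qed.

Variables (C : triCat R) (w : weightStr C) (t : tStr C) (sat : saturated C).
Hypotheses (w_bdd : w_bounded w) (wt : right_adjacent w t).

Lemma heart_embedding_essentially_surjective :
  noetherian R -> essentially_surjective (heart_embedding w t sat).
Proof.
move=> R_noeth Phi0; have [D] := wDecs_exists w.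
pose Phi : linFunctor (op (fullsub (inHeart w))) (modCat R) :=
  @fg_forget (op (wHeart w)) Phi0.
have Phi_fg P : fin_gen (Phi P) := svalP (Phi0 P).
have /sat[N [a [b [/= ba ab]]]] := heart_ext_finite_type D w_bdd R_noeth Phi_fg.
have N0 (X : C) : (forall u : heart_ext D Phi X, u = 0) -> forall f : @lhom R C X N, f = 0.
  by move=> X0 f; rewrite -[f](nt_cancel ab) (X0 (b X f)) linear0.
have hN : tle0 t N /\ tge0 t N.
  split; last first.
    by apply: (right_orth_tge0 wt) => X X1; apply/N0/heart_ext_wge1.
  by apply/wt/wge0E/wge_orth => X X1; apply/N0/heart_ext_wleN1.
exists (exist _ N hN).
pose c (P : op (wHeart w)) : {linear sval (Phi0 P) -> lhom (sval P) N} :=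
  (a (sval P) : {linear (heart_ext D Phi (sval P) : lmodType R) -> lhom (sval P) N})
    \o heart_unit D Phi P.
pose F : linFunctor (op (wHeart w)) (fgMod R) := fobj (heart_embedding w t sat) (exist _ N hN).
have c_nat (P Q : op (wHeart w)) (f : lhom P Q) :
    @lcomp R (fgMod R) (Phi0 P) (Phi0 Q) (F Q) (c Q) (lfmap Phi0 f) =
    @lcomp R (fgMod R) (Phi0 P) (F P) (F Q) (lfmap F f) (c P).
  apply: linear_ext => x /=.
  have := @heart_unit_natural _ _ _ D Phi Q P f x.
  move=> /(congr1 (a (sval Q) : {linear _ -> lhom (sval Q) N})) E.
  by apply: etrans E _; rewrite nt_pull.
apply: (@nt_iso _ _ _ (@NatTrans R (op (wHeart w)) (fgMod R) Phi0 F c c_nat)) => P /=.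
  move=> x y /(congr1 (b (sval P))).
  by rewrite /= !(nt_cancel ba) => /heart_unit_inj.
move=> y; have [x xE] := heart_unit_surj (b (sval P) y).
by exists x; rewrite /= xE (nt_cancel ab).
Qed.
End EssentialSurjectivity.

Theorem proposition3p1p7 (R : comPzRingType) (C : triCat R) (w : weightStr C)
    (w_bdd : w_bounded w) :
  (forall (D : wDecs w) (H : linFunctor (op C) (modCat R)),
     finite_type H ->
     forall n : int, finite_type (tau_leN D H n) /\ finite_type (tau_geN D H n))
  /\
  (forall sat : saturated C,
     [/\ forall (D : wDecs w) (i : int) (M : C),
           representable (tau_leN D (yoneda M) i) /\
           representable (tau_geN D (yoneda M) i),
         exists t : tStr C, right_adjacent w t
       & forall t : tStr C, right_adjacent w t ->
           fully_faithful (heart_embedding w t sat) /\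
           (noetherian R -> essentially_surjective (heart_embedding w t sat))]).
Proof.
split=> [D H H_fin n|sat].
  have [H_coh _ _] := H_fin.
  by split; [apply: tau_le_finite_type|apply: tau_ge_finite_type].
split=> [D i M||t wt].
- exact: tau_yoneda_representable.
- by exists (adjacent_tStr w_bdd sat).
- split; first exact: heart_embedding_fully_faithful.
  exact: heart_embedding_essentially_surjective.
Qed.
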